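(* Let $S$ be a finite nonempty set of primes, $l=\#S$, $d,m\ge1$, $n=d+m$. For each $\nu\in S$ let $\mathcal{U}_\nu\subseteq\mathbb{Z}_\nu^d$ be open, $\mathbf{f}_\nu:\mathcal{U}_\nu\to\mathbb{Z}_\nu^m$ a $C^2$ map, $\mathbf{F}_\nu(\mathbf{x})=(\mathbf{x},\mathbf{f}_\nu(\mathbf{x}))$, $\mathcal{M}_\nu=\mathbf{F}_\nu(\mathcal{U}_\nu)$, $\mathcal{U}=\prod_\nu\mathcal{U}_\nu$, $\mathcal{M}=\prod_\nu\mathcal{M}_\nu$, $\mathbf{F}((\mathbf{x}_\nu)_\nu)=(\mathbf{F}_\nu(\mathbf{x}_\nu))_\nu$. Let $\boldsymbol{\tau}=(\tau_{i,\nu})\in\mathbb{R}_+^{nl}$ satisfy (a) $\sum_{i,\nu}\tau_{i,\nu}=n+1$; (b) $\min_{1\le i\le d}\tau_{i,\nu}\ge\max_{1\le j\le m}\tau_{d+j,\nu}$ for all $\nu\in S$; (c) $\sum_{\nu\in S}\tau_{i,\nu}>1$ for all $1\le i\le n$. For $0<\alpha<\min\{\min_{\nu,i}\tau_{i,\nu},1\}$ and $\nu\in S$ define $\boldsymbol{\tau}^{\nu,\alpha}\in\mathbb{R}_+^{nl}$ by $$\tau^{\nu,\alpha}_{i,\nu}=\frac{(\tau_{i,\nu}-\alpha)(n+1)}{n+1-n\alpha},\qquad\tau^{\nu,\alpha}_{i,\sigma}=\frac{\tau_{i,\sigma}(n+1)}{n+1-n\alpha}\ (\sigma\in S\setminus\{\nu\}).$$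 Suppose there exists such an $\alpha$ for which, for every $\nu\in S$ with $\min_{1\le i\le n}\tau_{i,\nu}\le1$, $\omega_{\boldsymbol{\tau}^{\nu,\alpha}}(\mathcal{M})<1+\frac{\alpha}{(1-\alpha)(n+1)}$. Then $\mu_{S,d}\big(\mathbf{F}^{-1}(\mathbf{Bad}^{(S)}_n(\boldsymbol{\tau}))\big)=0$.
   Context: For a prime $\nu$, $\mathbb{Q}_\nu$ is the $\nu$-adic field with $|\nu|_\nu=\nu^{-1}$, $\mathbb{Z}_\nu=\{|x|_\nu\le1\}$; $C^2$ in the ultrametric sense. $\mathbb{Q}_S=\prod_{\nu\in S}\mathbb{Q}_\nu$, $\mathbb{Z}_S=\prod\mathbb{Z}_\nu$, $\mu_{S,k}$ Haar measure on $\mathbb{Q}_S^k$ with $\mu_{S,k}(\mathbb{Z}_S^k)=1$; points of $\mathbb{Q}_S^n$ are $\mathbf{y}=(y_{i,\nu})$. For $\tilde{\mathbf{b}}=(b_0,\dots,b_n)\in\mathbb{Z}^{n+1}$, $\|\tilde{\mathbf{b}}\|_\infty=\max_i|b_i|$. For $c>0$, $W(c;\boldsymbol{\tau})$ is the set of $\mathbf{y}\in\mathbb{Z}_S^n$ such that for infinitely many $\tilde{\mathbf{b}}$, $|b_0y_{i,\nu}-b_i|_\nu<c\|\tilde{\mathbf{b}}\|_\infty^{-\tau_{i,\nu}}$ for all $i,\nu$; $\mathbf{Bad}^{(S)}_n(\boldsymbol{\tau})=W(1;\boldsymbol{\tau})\setminus\bigcap_kW(\tfrac1k;\boldsymbol{\tau})$.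 For weights $\boldsymbol{\kappa}=(\kappa_{i,\nu})$ with positive entries summing to $n+1$ and $\mathbf{y}\in\mathbb{Q}_S^n$: $\omega_{\boldsymbol{\kappa}}(\mathbf{y})=\sup\{\omega:\max_{i,\nu}|b_0y_{i,\nu}+b_i|_\nu^{1/\kappa_{i,\nu}}\le\|\tilde{\mathbf{b}}\|_\infty^{-\omega}\text{ for infinitely many }\tilde{\mathbf{b}}\in\mathbb{Z}^{n+1}\}$, and $\omega_{\boldsymbol{\kappa}}(\mathcal{M})=\inf\{\omega:\omega_{\boldsymbol{\kappa}}(\mathbf{F}(\mathbf{x}))\le\omega\text{ for }\mu_{S,d}\text{-a.e. }\mathbf{x}\in\mathcal{U}\}$. *)

(* Defs.v *)
From HB Require Import structures.
From mathcomp Require Import all_boot all_order all_algebra finmap.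
From mathcomp Require Import all_classical all_reals all_analysis.

Set Implicit Arguments.
Unset Strict Implicit.
Unset Printing Implicit Defensive.

Import Order.TTheory GRing.Theory Num.Theory.
Local Open Scope classical_set_scope.
Local Open Scope ring_scope.

Definition primeNat := {p : nat | prime p}.

(* The ring of p-adic integers as the inverse limit of the Z/p^n: the n-th
   component is the representative of the residue class mod p^n in [0, p^n). *)
Section PadicInt.
Local Open Scope nat_scope.
Variable q : primeNat.
Let p : nat := val q.

Record padic_int := PadicInt {
  residue :> nat -> nat ;
  residueP : forall n, residue n = residue n.+1 %% p ^ n }.

Let p_pr : prime p. Proof. exact: valP q. Qed.
Let p_gt1 : 1 < p. Proof. exact: prime_gt1. Qed.
Let pX_gt0 n : 0 < p ^ n. Proof. by rewrite expn_gt0 prime_gt0. Qed.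

HB.instance Definition _ := gen_eqMixin padic_int.
HB.instance Definition _ := gen_choiceMixin padic_int.

Lemma padic_int_inj (x y : padic_int) : residue x =1 residue y -> x = y.
Proof.
case: x y => [x Px] [y Py] /= /funext exy; subst y.
by congr PadicInt; exact: Prop_irrelevance.
Qed.

Lemma residue_small (x : padic_int) n : x n %% p ^ n = x n.
Proof. by rewrite (residueP x n) modn_mod. Qed.

Lemma residue_add (x : padic_int) n k : x n = x (n + k) %% p ^ n.
Proof.
elim: k => [|k IH]; first by rewrite addn0 residue_small.
by rewrite IH addnS (residueP x (n + k)) modn_dvdm// dvdn_exp2l// leq_addr.
Qed.

Lemma padic_int_of_subproof (f : nat -> nat) :
  (forall n, f n.+1 = f n %[mod p ^ n]) ->
  forall n, f n %% p ^ n = (f n.+1 %% p ^ n.+1) %% p ^ n.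
Proof. by move=> fP n; rewrite modn_dvdm ?fP// dvdn_exp2l. Qed.

Definition padic_int_of f fP : padic_int :=
  PadicInt (@padic_int_of_subproof f fP).

Lemma padic_add_subproof (x y : padic_int) n :
  x n.+1 + y n.+1 = x n + y n %[mod p ^ n].
Proof. by rewrite (residueP x n) (residueP y n) modnDm. Qed.

Lemma padic_mul_subproof (x y : padic_int) n :
  x n.+1 * y n.+1 = x n * y n %[mod p ^ n].
Proof. by rewrite (residueP x n) (residueP y n) modnMm. Qed.

Lemma padic_opp_subproof (x : padic_int) n :
  p ^ n.+1 - x n.+1 = p ^ n - x n %[mod p ^ n].
Proof.
have le k : x k <= p ^ k by rewrite -residue_small ltnW ?ltn_mod.
apply/eqP; rewrite -(eqn_modDr (x n.+1)) subnK ?le//.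
have /eqP -> : p ^ n - x n + x n.+1 == p ^ n - x n + x n %[mod p ^ n].
  by rewrite eqn_modDl (residueP x n) modn_mod.
by rewrite subnK ?le// expnS modnMl modnn.
Qed.

Definition padic_int_add x y := padic_int_of (padic_add_subproof x y).
Definition padic_int_mul x y := padic_int_of (padic_mul_subproof x y).
Definition padic_int_opp x := padic_int_of (padic_opp_subproof x).
Definition padic_int_zero := @padic_int_of (fun=> 0) (fun=> erefl).
Definition padic_int_one := @padic_int_of (fun=> 1) (fun=> erefl).

Fact padic_int_addA : associative padic_int_add.
Proof.
by move=> x y z; apply: padic_int_inj => n /=; rewrite modnDmr modnDml addnA.
Qed.

Fact padic_int_addC : commutative padic_int_add.
Proof. by move=> x y; apply: padic_int_inj => n /=; rewrite addnC. Qed.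

Fact padic_int_add0 : left_id padic_int_zero padic_int_add.
Proof.
by move=> x; apply: padic_int_inj => n /=; rewrite mod0n add0n residue_small.
Qed.

Fact padic_int_addN : left_inverse padic_int_zero padic_int_opp padic_int_add.
Proof.
move=> x; apply: padic_int_inj => n /=.
by rewrite modnDml subnK ?modnn ?mod0n// -residue_small ltnW ?ltn_mod.
Qed.

HB.instance Definition _ := GRing.isZmodule.Build padic_int
  padic_int_addA padic_int_addC padic_int_add0 padic_int_addN.

Fact padic_int_mulA : associative padic_int_mul.
Proof.
by move=> x y z; apply: padic_int_inj => n /=; rewrite modnMmr modnMml mulnA.
Qed.

Fact padic_int_mulC : commutative padic_int_mul.
Proof. by move=> x y; apply: padic_int_inj => n /=; rewrite mulnC. Qed.

Fact padic_int_mul1 : left_id padic_int_one padic_int_mul.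
Proof.
by move=> x; apply: padic_int_inj => n /=; rewrite modnMml mul1n residue_small.
Qed.

Fact padic_int_mulDl : left_distributive padic_int_mul padic_int_add.
Proof.
move=> x y z; apply: padic_int_inj => n /=.
by rewrite modnMml modnDm mulnDl.
Qed.

Fact padic_int_1neq0 : padic_int_one != padic_int_zero.
Proof.
apply/eqP => /(congr1 (fun x : padic_int => x 1)) /=.
by rewrite mod0n expn1 modn_small.
Qed.

HB.instance Definition _ := GRing.Zmodule_isComNzRing.Build padic_int
  padic_int_mulA padic_int_mulC padic_int_mul1 padic_int_mulDl padic_int_1neq0.

(* For x != 0, the largest n with x = 0 mod p^n. *)
Definition padic_int_val (x : padic_int) : nat :=
  if pselect (exists n, x n.+1 != 0) is left e then ex_minn e else 0.

Lemma padic_int_valP (x : padic_int) : (x != 0)%R ->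
  x (padic_int_val x) = 0 /\ x (padic_int_val x).+1 != 0.
Proof.
move=> x0; rewrite /padic_int_val; case: pselect => [e|ne].
  case: ex_minnP => n xn min; split=> //.
  case: n xn min => [_ _|n _ min]; first by rewrite -residue_small modn1.
  by apply/eqP/negP => /negP /min; rewrite ltnn.
exfalso; move/eqP: x0; apply; apply: padic_int_inj => n /=; rewrite mod0n.
apply/eqP/negP => /negP xn; case: n xn => [|n xn].
  by rewrite -residue_small modn1.
by apply: ne; exists n.
Qed.

Lemma padic_int_neq0 (x : padic_int) n : x n != 0 -> (x != 0)%R.
Proof. by apply: contra => /eqP -> /=; rewrite mod0n. Qed.

Lemma padic_int_val_uniq (x : padic_int) n :
  x n = 0 -> x n.+1 != 0 -> padic_int_val x = n.
Proof.
move=> xn xSn; have [xv xSv] := padic_int_valP (padic_int_neq0 xSn).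
have mono a b : a <= b -> x b = 0 -> x a = 0.
  by move=> /subnKC <- e; rewrite (residue_add x a (b - a)) e mod0n.
apply/eqP; rewrite eqn_leq; apply/andP; split; rewrite leqNgt; apply/negP => lt.
  by move/eqP: xSn; apply; exact: mono lt xv.
by move/eqP: xSv; apply; exact: mono lt xn.
Qed.

Lemma residue_eq0 (x : padic_int) n k : (x n == 0) = (p ^ n %| x (n + k)).
Proof. by rewrite (residue_add x n k). Qed.

Lemma padic_int_mul_val (x y : padic_int) n m :
  x n = 0 -> x n.+1 != 0 -> y m = 0 -> y m.+1 != 0 ->
  ((x * y)%R : padic_int) (n + m) = 0 /\
  ((x * y)%R : padic_int) (n + m).+1 != 0.
Proof.
move=> xn xSn ym ySm; split=> /=.
  apply/eqP; rewrite -/(dvdn _ _) expnD dvdn_mul//.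
    by rewrite -residue_eq0 xn.
  by rewrite addnC -residue_eq0 ym.
have nx : ~~ (p ^ n.+1 %| x (n + m).+1) by rewrite -addSn -residue_eq0.
have ny : ~~ (p ^ m.+1 %| y (n + m).+1) by rewrite addnC -addSn -residue_eq0.
have x0 : 0 < x (n + m).+1 by rewrite lt0n; apply: contraNneq nx => ->.
have y0 : 0 < y (n + m).+1 by rewrite lt0n; apply: contraNneq ny => ->.
rewrite -/(dvdn _ _) pfactor_dvdn ?muln_gt0 ?x0 ?y0// lognM//.
rewrite -ltnNge ltnS leq_add//.
  by rewrite -ltnS ltnNge -pfactor_dvdn.
by rewrite -ltnS ltnNge -pfactor_dvdn.
Qed.

Lemma padic_int_integral (x y : padic_int) :
  (x * y = 0 -> (x == 0) || (y == 0))%R.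
Proof.
move=> xy0; apply/orP; case: eqVneq => [|x0]; first by left.
case: eqVneq => [|y0]; [by right|exfalso].
have [xv xSv] := padic_int_valP x0; have [yv ySv] := padic_int_valP y0.
have [_ /padic_int_neq0] := padic_int_mul_val xv xSv yv ySv.
by rewrite xy0 eqxx.
Qed.

Definition padic_int_unit : pred padic_int := fun x => `[< exists y, y * x = 1 >]%R.
Definition padic_int_inv (x : padic_int) : padic_int :=
  if pselect (exists y, y * x = 1)%R is left e then sval (cid e) else x.

Fact padic_int_mulVx : {in padic_int_unit, left_inverse 1 padic_int_inv *%R}%R.
Proof.
move=> x /asboolP xu; rewrite /padic_int_inv; case: pselect => // e.
by case: cid.
Qed.

Fact padic_int_unitPl (x y : padic_int) : (y * x = 1 -> padic_int_unit x)%R.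
Proof. by move=> yx; apply/asboolP; exists y. Qed.

Fact padic_int_invr_out :
  {in [predC padic_int_unit], padic_int_inv =1 id}.
Proof.
move=> x /asboolP xu; rewrite /padic_int_inv; case: pselect => //.
Qed.

HB.instance Definition _ := GRing.ComNzRing_hasMulInverse.Build padic_int
  padic_int_mulVx padic_int_unitPl padic_int_invr_out.
HB.instance Definition _ := GRing.ComUnitRing_isIntegral.Build padic_int
  padic_int_integral.

End PadicInt.

Definition padic (q : primeNat) : Type := {fraction (padic_int q)}.

HB.instance Definition _ q := GRing.Field.on (padic q).

Section PadicNorm.
Variable q : primeNat.
Let p : nat := val q.
Local Notation Zp := (padic_int q).
Local Notation "x %:F" := (@FracField.tofrac Zp x).

Let p_pr : prime p. Proof. exact: valP q. Qed.
Let p_gt0 : 0 < p%:R :> rat. Proof. by rewrite ltr0n prime_gt0. Qed.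

Definition padic_int_norm (x : Zp) : rat :=
  if x == 0 then 0 else p%:R ^- padic_int_val x.

(* |x / y| = |x| / |y|, read off the chosen numerator and denominator. *)
Definition padic_norm (z : padic q) : rat :=
  padic_int_norm (frac (repr z)).1 / padic_int_norm (frac (repr z)).2.

Lemma padic_int_norm_ge0 x : 0 <= padic_int_norm x.
Proof.
by rewrite /padic_int_norm; case: ifP => // _; rewrite invr_ge0 exprn_ge0// ltW.
Qed.

Lemma padic_int_norm_eq0 x : (padic_int_norm x == 0) = (x == 0).
Proof.
rewrite /padic_int_norm; case: ifP => [|_]; first by rewrite eqxx.
by apply/negbTE; rewrite invr_eq0 expf_neq0 ?gt_eqF.
Qed.

Lemma padic_int_normM x y :
  padic_int_norm (x * y) = padic_int_norm x * padic_int_norm y.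
Proof.
rewrite /padic_int_norm mulf_eq0; case: eqVneq => [_|x0]; first by rewrite mul0r.
case: eqVneq => [_|y0] /=; first by rewrite mulr0.
have [xv xSv] := padic_int_valP x0; have [yv ySv] := padic_int_valP y0.
have [xyv xySv] := padic_int_mul_val xv xSv yv ySv.
by rewrite (padic_int_val_uniq xyv xySv) exprD invfM.
Qed.

Lemma padic_int_normD x y :
  padic_int_norm (x + y) <= Num.max (padic_int_norm x) (padic_int_norm y).
Proof.
have [->|x0] := eqVneq x 0; first by rewrite add0r le_max lexx orbT.
have [->|y0] := eqVneq y 0; first by rewrite addr0 le_max lexx.
rewrite {1}/padic_int_norm; case: eqVneq => [_|xy0].
  by rewrite le_max padic_int_norm_ge0.
rewrite /padic_int_norm (negbTE x0) (negbTE y0).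
have [[xv _] [yv _]] := (padic_int_valP x0, padic_int_valP y0).
have [_ xySv] := padic_int_valP xy0.
set v := padic_int_val (x + y) in xySv *.
suff le : (minn (padic_int_val x) (padic_int_val y) <= v)%N.
  have mono a b : (a <= b)%N -> p%:R ^- b <= p%:R ^- a :> rat.
    by move=> ab; rewrite lef_pV2 ?posrE ?exprn_gt0// ler_weXn2l// ler1n prime_gt0.
  by move: le; rewrite geq_min le_max => /orP[] /mono ->; rewrite ?orbT.
rewrite leqNgt; apply/negP; rewrite leq_min => /andP[vx vy].
have mono (z : Zp) a b : (a <= b)%N -> z b = 0%N -> z a = 0%N.
  by move=> /subnKC <- e; rewrite (residue_add z a (b - a)) e mod0n.
by move: xySv => /=; rewrite (mono x _ _ vx xv) (mono y _ _ vy yv) mod0n eqxx.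
Qed.

Lemma padic_reprE (z : padic q) :
  z = (frac (repr z)).1%:F / (frac (repr z)).2%:F.
Proof.
have d0 : (frac (repr z)).2 != 0 by exact: denom_ratioP.
apply: (@mulIf _ (frac (repr z)).2%:F); first by rewrite tofrac_eq0.
rewrite divfK ?tofrac_eq0//; unlock FracField.tofrac.
rewrite -[X in X * _](reprK z) -[LHS]FracField.pi_mul.
apply/eqmodP => /=; rewrite FracField.equivfE /FracField.mulf.
by rewrite !numden_Ratio ?mulr1 ?oner_neq0// mulrC.
Qed.

Lemma padic_norm_frac x y : y != 0 ->
  padic_norm (x%:F / y%:F) = padic_int_norm x / padic_int_norm y.
Proof.
move=> y0; rewrite /padic_norm; set z := x%:F / y%:F.
have d0 : (frac (repr z)).2 != 0 by exact: denom_ratioP.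
apply/eqP; rewrite eqr_div ?padic_int_norm_eq0// -!padic_int_normM; apply/eqP.
congr padic_int_norm; apply/eqP; rewrite -tofrac_eq !rmorphM/=.
by rewrite -eqr_div ?tofrac_eq0// -padic_reprE.
Qed.

Lemma padic_norm_int x : padic_norm x%:F = padic_int_norm x.
Proof.
have n1 : padic_int_norm 1 = 1.
  have n10 : padic_int_norm 1 != 0 by rewrite padic_int_norm_eq0 oner_neq0.
  by apply: (mulfI n10); rewrite -padic_int_normM !mulr1.
by rewrite -[x%:F]divr1 -(rmorph1 (@FracField.tofrac Zp)) padic_norm_frac
  ?oner_neq0// n1 divr1.
Qed.

Lemma padic_norm_ge0 z : 0 <= padic_norm z.
Proof. by rewrite divr_ge0 ?padic_int_norm_ge0. Qed.

Lemma padic_norm_eq0 z : (padic_norm z == 0) = (z == 0).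
Proof.
have d0 : (frac (repr z)).2 != 0 by exact: denom_ratioP.
rewrite /padic_norm mulf_eq0 invr_eq0 !padic_int_norm_eq0 (negbTE d0) orbF.
by rewrite {2}(padic_reprE z) mulf_eq0 invr_eq0 !tofrac_eq0 (negbTE d0) orbF.
Qed.

Lemma padic_normM z w : padic_norm (z * w) = padic_norm z * padic_norm w.
Proof.
rewrite {1}(padic_reprE z) {1}(padic_reprE w) mulf_div -!rmorphM/=.
by rewrite padic_norm_frac ?mulf_neq0 ?denom_ratioP// !padic_int_normM mulf_div.
Qed.

Lemma padic_normD z w :
  padic_norm (z + w) <= Num.max (padic_norm z) (padic_norm w).
Proof.
have [d0 e0] : (frac (repr z)).2 != 0 /\ (frac (repr w)).2 != 0.
  by split; exact: denom_ratioP.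
have gt0 x : x != 0 -> 0 < padic_int_norm x.
  by move=> x0; rewrite lt_neqAle padic_int_norm_ge0 eq_sym padic_int_norm_eq0 x0.
rewrite {1}(padic_reprE z) {1}(padic_reprE w) addf_div ?tofrac_eq0//.
rewrite -!rmorphM -rmorphD/= padic_norm_frac ?mulf_neq0// ler_pdivrMr ?gt0 ?mulf_neq0//.
apply: le_trans (padic_int_normD _ _) _; rewrite !padic_int_normM.
rewrite maxr_pMl ?mulr_ge0 ?padic_int_norm_ge0// /padic_norm.
by rewrite mulrA divfK ?padic_int_norm_eq0// mulrCA divfK ?padic_int_norm_eq0// mulrC
  [X in Num.max _ X]mulrC.
Qed.

Lemma padic_normN z : padic_norm (- z) = padic_norm z.
Proof.
have n1 : padic_norm 1 = 1.
  have n10 : padic_norm 1 != 0 by rewrite padic_norm_eq0 oner_neq0.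
  by apply: (mulfI n10); rewrite -padic_normM !mulr1.
rewrite -mulN1r padic_normM; suff -> : padic_norm (-1) = 1 by rewrite mul1r.
apply/eqP; rewrite -(@eqrXn2 _ 2) ?padic_norm_ge0// expr1n expr2.
by rewrite -padic_normM mulrNN mulr1 n1.
Qed.

Lemma padic_norm_prime : padic_norm p%:R = p%:R^-1.
Proof.
have p_gt1 := prime_gt1 p_pr.
have nat_res n k : (n%:R : Zp) k = (n %% p ^ k)%N.
  elim: n => [|n IH]; first by rewrite mulr0n.
  by rewrite -addn1 natrD /= IH modnDm.
have -> : p%:R = (p%:R : Zp)%:F :> padic q by rewrite rmorph_nat.
have r1 : (p%:R : Zp) 1%N = 0%N by rewrite nat_res expn1 modnn.
have r2 : (p%:R : Zp) 2%N != 0%N.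
  by rewrite nat_res modn_small -?lt0n ?prime_gt0// -{1}(expn1 p) ltn_exp2l.
by rewrite padic_norm_int /padic_int_norm (negbTE (padic_int_neq0 r2))
  (padic_int_val_uniq r1 r2) expr1.
Qed.

Definition padic_dist (x y : padic q) : rat := padic_norm (x - y).

Fact padic_distxx x : padic_dist x x = 0.
Proof. by apply/eqP; rewrite /padic_dist padic_norm_eq0 subrr. Qed.

Fact padic_dist_eq0 x y : padic_dist x y = 0 -> x = y.
Proof. by move/eqP; rewrite padic_norm_eq0 subr_eq0 => /eqP. Qed.

Fact padic_dist_sym x y : padic_dist x y = padic_dist y x.
Proof. by rewrite /padic_dist -padic_normN opprB. Qed.

Fact padic_dist_triangle y x z :
  padic_dist x z <= padic_dist x y + padic_dist y z.
Proof.
rewrite /padic_dist -[x - z](subrKA y); apply: le_trans (padic_normD _ _) _.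
by rewrite ge_max lerDl lerDr !padic_norm_ge0.
Qed.

End PadicNorm.

HB.instance Definition _ q := isPointed.Build (padic q) 0.
HB.instance Definition _ q := @isMetric.Build rat (padic q) (@padic_dist q)
  (@padic_distxx q) (@padic_dist_eq0 q) (@padic_dist_sym q)
  (@padic_dist_triangle q).

(* C^2 in the sense of Schikhof and Kleinbock-Tomanov: on a product of subsets
   of Q_p, the partial difference quotients of total order at most 2, defined
   where the points used in each coordinate are pairwise distinct, extend to
   continuous functions on the full product. A map on an open set is C^2 if each
   point has an open box neighbourhood on which its components are C^2. *)
Section UltrametricC2.
Variables (q : primeNat) (d : nat).
Local Notation K := (padic q).

Definition set_coord (x : 'rV[K]_d) (i : 'I_d) (s : K) : 'rV[K]_d :=
  \row_j (if j == i then s else x 0 j).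

Definition diff_quot (i : 'I_d) (s : K) (g : 'rV[K]_d -> K) : 'rV[K]_d -> K :=
  fun x => (g x - g (set_coord x i s)) / (x 0 i - s).

Definition extends_continuously (T : topologicalType) (D E : set T) (h : T -> K) :=
  exists g : T -> K, {within D, continuous g} /\ {in E, g =1 h}.

Definition box (X : 'I_d -> set K) : set 'rV[K]_d :=
  [set x | forall i, X i (x 0 i)].

Definition C2_on_box (X : 'I_d -> set K) (g : 'rV[K]_d -> K) : Prop :=
  [/\ {within box X, continuous g},
      forall i : 'I_d,
        extends_continuously (box X `*` X i)
          [set z | (box X `*` X i) z /\ z.1 0 i != z.2]
          (fun z => diff_quot i z.2 g z.1)
    & forall i j : 'I_d,
        extends_continuously (box X `*` X i `*` X j)
          [set z | [/\ (box X `*` X i `*` X j) z, z.1.1 0 i != z.1.2,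
                       z.1.1 0 j != z.2 & i = j -> z.1.2 != z.2]]
          (fun z => diff_quot i z.1.2 (diff_quot j z.2 g) z.1.1)].

Definition C2_ultrametric (m : nat) (U : set 'rV[K]_d)
    (f : 'rV[K]_d -> 'rV[K]_m) : Prop :=
  forall a, U a -> exists X : 'I_d -> set K,
    [/\ forall i, open (X i), box X a, box X `<=` U &
        forall k, C2_on_box X (fun x => f x 0 k)].

End UltrametricC2.

Section SArithmetic.
Variable S : {fset primeNat}.

Definition QS (k : nat) : Type :=
  prod_topology (fun nu : S => 'rV[padic (val nu)]_k).

HB.instance Definition _ k := Topological.on (QS k).
HB.instance Definition _ k :=
  isPointed.Build (QS k) (fun=> 0).

Definition QS_borel (k : nat) := g_sigma_algebraType (@open (QS k)).

Definition Zp_pow (q : primeNat) (k : nat) : set 'rV[padic q]_k :=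
  [set x | forall i, padic_norm (x 0 i) <= 1].

Definition ZS (k : nat) : set (QS k) :=
  [set x | forall nu, Zp_pow (x nu)].

Definition QS_add (k : nat) (a x : QS k) : QS k := fun nu => a nu + x nu.

Variable R : realType.

(* The Haar measure of Q_S^k normalized by mu(Z_S^k) = 1: since Q_S^k is locally
   compact and second countable, these conditions determine mu on Borel sets. *)
Definition is_haar (k : nat) (mu : {measure set (QS_borel k) -> \bar R}) : Prop :=
  mu (@ZS k) = 1%E /\
  forall (a : QS k) (A : set (QS_borel k)), measurable A ->
    mu (QS_add a @` A) = mu A.

Definition height (n : nat) (b : 'rV[int]_n.+1) : R :=
  (\max_(i < n.+1) `|b ord0 i|)%N%:R.

Definition pnorm (q : primeNat) (x : padic q) : R := ratr (padic_norm x).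

Definition W (n : nat) (c : R) (tau : 'I_n -> S -> R) : set (QS n) :=
  [set y | ZS y /\ infinite_set [set b : 'rV[int]_n.+1 |
    forall (i : 'I_n) (nu : S),
      pnorm ((b 0 ord0)%:~R * y nu 0 i - (b 0 (lift ord0 i))%:~R)
        < c * height b `^ (- tau i nu)]].

Definition Bad (n : nat) (tau : 'I_n -> S -> R) : set (QS n) :=
  W 1 tau `\` \bigcap_(k in [set k | (0 < k)%N]) W k%:R^-1 tau.

(* The maxima of nonnegative numbers are taken with base value 0; the supremum
   (resp. the infimum below) is in the extended reals. *)
Definition omega (n : nat) (kappa : 'I_n -> S -> R) (y : QS n) : \bar R :=
  ereal_sup [set w%:E | w in [set w : R | infinite_set [set b : 'rV[int]_n.+1 |
    \big[Num.max/0]_(i < n) \big[Num.max/0]_(nu : S)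
      pnorm ((b 0 ord0)%:~R * y nu 0 i + (b 0 (lift ord0 i))%:~R)
        `^ (kappa i nu)^-1
    <= height b `^ (- w)]]].

Definition omega_mfd (d n : nat) (mu : {measure set (QS_borel d) -> \bar R})
    (U : set (QS d)) (F : QS d -> QS n) (kappa : 'I_n -> S -> R) : \bar R :=
  ereal_inf [set w%:E | w in [set w : R |
    {ae mu, forall x, U x -> (omega kappa (F x) <= w%:E)%E}]].

Definition prod_set (d : nat) (U : forall nu : S, set 'rV[padic (val nu)]_d) :
    set (QS d) :=
  [set x | forall nu, U nu (x nu)].

Definition graph_map (d m : nat)
    (f : forall nu : S, 'rV[padic (val nu)]_d -> 'rV[padic (val nu)]_m) :
    QS d -> QS (d + m) :=
  fun x nu => row_mx (x nu) (f nu (x nu)).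

(* The weights tau^{nu, alpha}. *)
Definition shifted_weight (n : nat) (tau : 'I_n -> S -> R) (nu : S) (alpha : R) :
    'I_n -> S -> R :=
  fun i sigma =>
    (if sigma == nu then tau i sigma - alpha else tau i sigma) * n.+1%:R
      / (n.+1%:R - n%:R * alpha).

End SArithmetic.

(* Main.v *)
(* Fix c = 1/k and a point x at which f is differentiable to second order, with
   differential D. Dirichlet's theorem is applied to the system
     |b_0 x_i - b_i| < C h^-tau_i,
     |b_0 f_j(x) - b_(d+j) - D_j (b_0 x - b)| < c h^-tau_(d+j),
   h being the height of b, where the large constant C pays for the small constant
   c. It yields boxes R_b = {y : |b_0 y_i - b_i| < C h^-tau_i} around x such that,
   by Taylor's formula at x, every y in a concentric box of comparable size
   satisfies all the inequalities with constant c; hypothesis (b) bounds the linear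
   and quadratic remainders. The exponent hypothesis makes R_b shrink to x: if
   |b_0|_nu <= h^-alpha, then b is divisible by a power of nu close to h^alpha, and
   the quotient would be too good an approximation for the weights tau^(nu,alpha).

   The boxes R_b have unbounded eccentricity, so Lebesgue's density theorem for
   balls does not apply. Instead, shrinking all boxes of a family in one coordinate
   by a fixed factor shrinks the measure of their union by at most that factor:
   in the ultrametric setting balls are nested or disjoint, and translation
   invariance of Haar measure suffices. Consequently a set E whose points all have
   small boxes around them with a proportional sub-box missing E is null. *)

Require Import Defs.
From mathcomp Require Import all_boot all_order all_algebra finmap.
From mathcomp Require Import all_classical all_reals all_analysis.
From mathcomp Require Import ring lra zify.

Set Implicit Arguments.
Unset Strict Implicit.
Unset Printing Implicit Defensive.

Import Order.TTheory GRing.Theory Num.Theory.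
Local Open Scope classical_set_scope.
Local Open Scope ring_scope.

(** * Residues of p-adic integers and approximation by natural numbers *)

Section PadicIntegers.
Variable q : primeNat.
Let p : nat := val q.
Local Notation Zp := (padic_int q).
Local Notation "x %:F" := (@FracField.tofrac Zp x).

Lemma prime_val_gt0 (r : primeNat) : (0 < val r)%N.
Proof. exact: prime_gt0 (valP r). Qed.

Lemma prime_val_gt1 (r : primeNat) : (1 < val r)%N.
Proof. exact: prime_gt1 (valP r). Qed.

Lemma padic_int_norm_le (u : Zp) k :
  (padic_int_norm u <= p%:R ^- k) = (u k == 0%N).
Proof.
rewrite /padic_int_norm; case: eqVneq => [->|u0].
  by rewrite /= mod0n eqxx invr_ge0 exprn_ge0.
have [uv uSv] := padic_int_valP u0; set v := padic_int_val u in uv uSv *.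
have p1 : 1 < p%:R :> rat by rewrite ltr1n prime_val_gt1.
have p0 : 0 < p%:R :> rat by rewrite ltr0n prime_val_gt0.
rewrite lef_pV2 ?posrE ?exprn_gt0// ler_eXn2l//; apply/idP/eqP => [kv|uk].
  by rewrite (residue_add u k (v - k)) subnKC// uv mod0n.
rewrite leqNgt; apply/negP => vk; move/eqP: uSv; apply.
by rewrite (residue_add u v.+1 (k - v.+1)) subnKC// uk mod0n.
Qed.

Lemma padic_int_natE n k : (n%:R : Zp) k = (n %% p ^ k)%N.
Proof.
elim: n => [|n IH]; first by rewrite mulr0n.
by rewrite -addn1 natrD /= IH modnDm.
Qed.

Lemma padic_norm_nat_le (a k : nat) :
  (padic_norm (a%:R : padic q) <= p%:R ^- k) = (p ^ k %| a)%N.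
Proof.
have -> : a%:R = (a%:R : Zp)%:F :> padic q by rewrite rmorph_nat.
by rewrite padic_norm_int padic_int_norm_le padic_int_natE.
Qed.

Lemma padic_int_norm_residue (x : Zp) k :
  padic_int_norm (x - (x k)%:R) <= p%:R ^- k.
Proof.
rewrite padic_int_norm_le /= padic_int_natE residue_small modnDmr subnKC ?modnn//.
by rewrite -residue_small ltnW// ltn_mod expn_gt0 prime_val_gt0.
Qed.

Lemma padic_normD_le (z w : padic q) e :
  padic_norm z <= e -> padic_norm w <= e -> padic_norm (z + w) <= e.
Proof.
by move=> ze we; apply: le_trans (padic_normD _ _) _; rewrite ge_max ze.
Qed.

Lemma padic_norm_nat_le1 (a : nat) : padic_norm (a%:R : padic q) <= 1.
Proof. by have := padic_norm_nat_le a 0; rewrite expr0 invr1 expn0 dvd1n. Qed.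

Lemma padic_norm1 : padic_norm (1 : padic q) = 1.
Proof.
have n10 : padic_norm (1 : padic q) != 0 by rewrite padic_norm_eq0 oner_neq0.
by apply: (mulfI n10); rewrite -padic_normM !mulr1.
Qed.

(** An element of [padic q] is only given as a fraction [x / y], so its digits come from solving
    [x + w y = 0] modulo [p ^ m]. With [v] the valuation of [y], this is solvable because [|z| <= 1]
    forces [p ^ v] to divide [x]; dividing by [y] costs [v] digits, hence the working precision [m]
    exceeds the target by [v]. *)
Lemma padic_approx_nat (z : padic q) k : padic_norm z <= 1 ->
  exists2 u, (u < p ^ k)%N & padic_norm (z - u%:R) <= p%:R ^- k.
Proof.
have pX j : (0 < p ^ j)%N by rewrite expn_gt0 prime_val_gt0.
(* For a positive target [m] is larger than [v], so the residue of [y] at level [m] is not divisible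
   by [p ^ v.+1]. *)
case: k => [z1|k].
  by exists 0%N; rewrite ?expn0// subr0 expr0 invr1.
set x := (frac (repr z)).1; set y := (frac (repr z)).2 => z1.
have y0 : y != 0 by exact: denom_ratioP.
have zE : z = x%:F / y%:F by exact: padic_reprE.
have [yv ySv] := padic_int_valP y0; set v := padic_int_val y in yv ySv.
have ny : padic_int_norm y = p%:R ^- v by rewrite /padic_int_norm (negbTE y0).
have py : 0 < padic_int_norm y.
  by rewrite lt_neqAle padic_int_norm_ge0 eq_sym padic_int_norm_eq0 y0.
have nx : padic_int_norm x <= p%:R ^- v.
  by move: z1; rewrite zE padic_norm_frac// ler_pdivrMr// mul1r ny.
have /eqP xv : x v == 0%N by rewrite -padic_int_norm_le.
set m := (v + k.+1)%N; set A := x m; set B := y m.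
have pA : (p ^ v %| A)%N by rewrite -residue_eq0 xv.
have pB : ~~ (p ^ v.+1 %| B)%N by rewrite /B /m addnS -addSn -residue_eq0.
have [a _ ma] := Bezoutl B (pX m).
(* The gcd is a power of [p] dividing [B], so its exponent is at most [v]. *)
have gA : (gcdn (p ^ m) B %| A)%N.
  apply: dvdn_trans pA.
  have /(dvdn_pfactor _ _ (valP q))[j _ gE] := dvdn_gcdl (p ^ m) B.
  rewrite gE dvdn_exp2l// -ltnS ltnNge; apply: contra pB => vj.
  by apply: dvdn_trans (dvdn_gcdr (p ^ m) B); rewrite gE dvdn_exp2l.
have [A' AE] := dvdnP gA; set w := (A' * a)%N.
have mAB : (p ^ m %| A + w * B)%N.
  by rewrite AE /w -mulnA -mulnDr dvdn_mull// addnC.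
have xy : padic_norm (x%:F + w%:R * y%:F) <= p%:R ^- m.
  have -> : x%:F + w%:R * y%:F =
      (x - (x m)%:R)%:F + w%:R * (y - (y m)%:R)%:F + (A + w * B)%:R.
    rewrite !rmorphB/= !rmorph_nat natrD natrM -/A -/B; ring.
  apply: padic_normD_le; last by rewrite padic_norm_nat_le.
  apply: padic_normD_le; first by rewrite padic_norm_int padic_int_norm_residue.
  rewrite padic_normM padic_norm_int -[leRHS]mul1r ler_pM ?padic_norm_ge0//.
    exact: padic_int_norm_ge0.
    exact: padic_norm_nat_le1.
  exact: padic_int_norm_residue.
have zw : padic_norm (z + w%:R) <= p%:R ^- k.+1.
  have -> : z + w%:R = (x%:F + w%:R * y%:F) / y%:F.
    by rewrite mulrDl mulfK ?tofrac_eq0// -zE.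
  have nV : padic_norm (y%:F)^-1 = p%:R ^+ v.
    apply: (@mulfI _ (padic_norm y%:F)).
      by rewrite padic_norm_eq0 tofrac_eq0.
    rewrite -padic_normM divff ?tofrac_eq0// padic_norm1 padic_norm_int ny.
    by rewrite mulVf// expf_neq0// pnatr_eq0 -lt0n prime_val_gt0.
  rewrite padic_normM nV -ler_pdivlMr ?exprn_gt0 ?ltr0n ?prime_val_gt0//.
  by rewrite -invfM -exprD addnC.
exists ((p ^ k.+1 - w %% p ^ k.+1) %% p ^ k.+1)%N; first by rewrite ltn_mod.
set u := (_ %% _)%N.
have -> : z - u%:R = z + w%:R - (w + u)%:R by rewrite natrD; ring.
apply: padic_normD_le => //; rewrite padic_normN padic_norm_nat_le.
rewrite /dvdn /u modnDmr -modnDml subnKC ?modnn//.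
by rewrite ltnW// ltn_mod.
Qed.

End PadicIntegers.

(** * The real-valued p-adic norm and its values on integers *)

Section Pnorm.
Variables (R : realType) (q : primeNat).
Let p : nat := val q.
Local Notation pn := (@pnorm R q).
Implicit Types (z w : padic q).

Lemma ratr_primeV k : ratr (p%:R ^- k : rat) = p%:R ^- k :> R.
Proof. by rewrite fmorphV rmorphXn/= ratr_nat. Qed.

Lemma pnorm_ge0 z : 0 <= pn z.
Proof. by rewrite /pnorm ler0q padic_norm_ge0. Qed.

Lemma pnorm_eq0 z : (pn z == 0) = (z == 0).
Proof. by rewrite /pnorm fmorph_eq0 padic_norm_eq0. Qed.

Lemma pnorm0 : pn 0 = 0.
Proof. by apply/eqP; rewrite pnorm_eq0. Qed.

Lemma pnorm1 : pn 1 = 1.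
Proof. by rewrite /pnorm padic_norm1 rmorph1. Qed.

Lemma pnormM z w : pn (z * w) = pn z * pn w.
Proof. by rewrite /pnorm padic_normM rmorphM. Qed.

Lemma pnormX z k : pn (z ^+ k) = pn z ^+ k.
Proof.
by elim: k => [|k IH]; rewrite ?expr0 ?pnorm1// !exprS pnormM IH.
Qed.

Lemma pnormN z : pn (- z) = pn z.
Proof. by rewrite /pnorm padic_normN. Qed.

Lemma pnormV z : pn z^-1 = (pn z)^-1.
Proof.
have [->|z0] := eqVneq z 0; first by rewrite invr0 pnorm0 invr0.
have nz : pn z != 0 by rewrite pnorm_eq0.
by apply: (mulfI nz); rewrite -pnormM !divff// pnorm1.
Qed.

Lemma pnormD z w : pn (z + w) <= Num.max (pn z) (pn w).
Proof.
rewrite /pnorm; have := padic_normD z w; rewrite -(ler_rat R) => /le_trans; apply.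
by rewrite le_max !ler_rat -le_max.
Qed.

Lemma pnormD_le z w e : pn z <= e -> pn w <= e -> pn (z + w) <= e.
Proof. by move=> ? ?; apply: le_trans (pnormD _ _) _; rewrite ge_max; apply/andP. Qed.

Lemma pnormB_le z w e : pn z <= e -> pn w <= e -> pn (z - w) <= e.
Proof. by move=> ? ?; rewrite pnormD_le// pnormN. Qed.

Lemma pnormD_lt z w e : pn z < e -> pn w < e -> pn (z + w) < e.
Proof. by move=> ? ?; apply: le_lt_trans (pnormD _ _) _; rewrite gt_max; apply/andP. Qed.

Lemma pnormB_lt z w e : pn z < e -> pn w < e -> pn (z - w) < e.
Proof. by move=> ? ?; rewrite pnormD_lt// pnormN. Qed.

Lemma pnorm_sum_le (I : Type) (s : seq I) (P : pred I) (F : I -> padic q) e :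
  0 <= e -> (forall i, P i -> pn (F i) <= e) -> pn (\sum_(i <- s | P i) F i) <= e.
Proof.
move=> e0 Fe; elim/big_ind: _ => //; first by rewrite pnorm0.
by move=> x y; exact: pnormD_le.
Qed.

Lemma pnorm_sum_lt (I : Type) (s : seq I) (P : pred I) (F : I -> padic q) e :
  0 < e -> (forall i, P i -> pn (F i) < e) -> pn (\sum_(i <- s | P i) F i) < e.
Proof.
move=> e0 Fe; elim/big_ind: _ => //; first by rewrite pnorm0.
by move=> x y; exact: pnormD_lt.
Qed.

Lemma pnorm_int_le1 (z : int) : pn z%:~R <= 1.
Proof.
have nat1 (n : nat) : pn n%:R <= 1.
  by rewrite /pnorm -(rmorph1 (@ratr R)) ler_rat padic_norm_nat_le1.
by case: z => n; rewrite ?NegzE ?mulrNz ?pnormN -pmulrn.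
Qed.

Lemma pnorm_int_le (z : int) k :
  (pn z%:~R <= p%:R ^- k) = (p ^ k %| `|z|)%N.
Proof.
have nat_le (n : nat) : (pn n%:R <= p%:R ^- k) = (p ^ k %| n)%N.
  by rewrite /pnorm -ratr_primeV ler_rat padic_norm_nat_le.
by case: z => n; rewrite ?NegzE ?mulrNz ?pnormN -pmulrn ?abszN nat_le.
Qed.

Lemma pnorm_prime : pn p%:R = p%:R^-1.
Proof. by rewrite /pnorm padic_norm_prime fmorphV/= ratr_nat. Qed.

Lemma pnorm_primeX k : pn (p%:R ^+ k) = p%:R ^- k.
Proof. by rewrite pnormX pnorm_prime exprVn. Qed.

Lemma prime_valR_gt0 : 0 < p%:R :> R.
Proof. by rewrite ltr0n prime_val_gt0. Qed.

Lemma prime_valR_gt1 : 1 < p%:R :> R.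
Proof. by rewrite ltr1n prime_val_gt1. Qed.

(** Bezout gives [1 = u a - v p]. If [|a| < 1], both terms have norm below 1, and the ultrametric
    inequality contradicts [|1| = 1]. *)
Lemma pnorm_coprime (a : nat) : coprime p a -> pn a%:R = 1.
Proof.
move=> pa; apply/eqP; rewrite eq_le; apply/andP; split.
  by have := pnorm_int_le1 a; rewrite -pmulrn.
rewrite leNgt; apply/negP => a1.
have a0 : (0 < a)%N.
  by case: a pa {a1} => //; rewrite /coprime gcdn0 => /eqP p1;
    have := prime_val_gt1 q; rewrite -/p p1.
have p0 : pn p%:R < 1 by rewrite pnorm_prime invf_lt1 ?prime_valR_gt1 ?prime_valR_gt0.
have [u v uv _] := egcdnP p a0.
move: uv; rewrite gcdnC (eqP pa) => uv.
have mul_lt (x : padic q) (k : nat) : pn x < 1 -> pn (k%:R * x) < 1.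
  move=> x1; rewrite pnormM; apply: le_lt_trans x1.
  rewrite -[leRHS]mul1r ler_wpM2r ?pnorm_ge0//.
  by have := pnorm_int_le1 k; rewrite -pmulrn.
suff : pn 1 < 1 by rewrite pnorm1 ltxx.
have -> : 1 = u%:R * a%:R - v%:R * p%:R :> padic q.
  by rewrite -!natrM uv natrD addrC addKr.
by apply: pnormB_lt; apply: mul_lt.
Qed.

Lemma pnorm_natE (a : nat) : (0 < a)%N -> pn a%:R = p%:R ^- logn p a.
Proof.
move=> a0; have [m pm am] := pfactor_coprime (valP q) a0.
by rewrite {1}am natrM natrX pnormM pnorm_coprime// mul1r pnorm_primeX.
Qed.

Lemma pnorm_intE (z : int) : z != 0 -> pn z%:~R = p%:R ^- logn p `|z|.
Proof.
move=> z0; rewrite -pnorm_natE ?absz_gt0//.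
by case: z {z0} => n; rewrite ?NegzE ?mulrNz ?pnormN -pmulrn ?abszN.
Qed.

Lemma pnorm_int_ge (z : int) : z != 0 -> (`|z|%N%:R)^-1 <= pn z%:~R.
Proof.
move=> z0; rewrite pnorm_intE// lef_pV2 ?posrE ?exprn_gt0 ?prime_valR_gt0//.
  by rewrite -natrX ler_nat dvdn_leq ?absz_gt0// pfactor_dvdnn.
by rewrite ltr0n absz_gt0.
Qed.

(** Division by [p ^ N] reduces this to [padic_approx_nat]. It splits a ball into [p ^ K] translates
    of a smaller one, the count behind both the covering and the pigeonhole argument. *)
Lemma pnorm_approx z (N K : nat) : pn z <= p%:R ^- N ->
  exists2 u, (u < p ^ K)%N & pn (z - u%:R * p%:R ^+ N) <= p%:R ^- (N + K).
Proof.
move=> zN; have pX0 : (p%:R ^+ N : padic q) != 0.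
  rewrite -pnorm_eq0 pnorm_primeX invr_eq0 expf_neq0// gt_eqF//.
  exact: prime_valR_gt0.
have : padic_norm (z / p%:R ^+ N) <= 1.
  rewrite -(ler_rat R) rmorph1 -[leLHS]/(pn _) pnormM pnormV pnorm_primeX invrK.
  by rewrite -ler_pdivlMr ?exprn_gt0 ?prime_valR_gt0// div1r.
move=> /padic_approx_nat - /(_ K)[u uK]; rewrite -(ler_rat R) -[leLHS]/(pn _).
rewrite ratr_primeV => zu; exists u => //.
have -> : z - u%:R * p%:R ^+ N = (z / p%:R ^+ N - u%:R) * p%:R ^+ N.
  by rewrite mulrBl divfK.
rewrite pnormM pnorm_primeX exprD invfM mulrC ler_pM2l//.
by rewrite invr_gt0 exprn_gt0 ?prime_valR_gt0.
Qed.

End Pnorm.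

(** Powers of distinct primes are coprime, so their product divides [a]. In terms of norms this is
    the product formula restricted to [S]: the product of the [|a|_nu] is at least [1 / a]. *)
Lemma prod_logn_le (S : {fset primeNat}) (a : nat) : (0 < a)%N ->
  (\prod_(nu : S) (val (val nu) ^ logn (val (val nu)) a) <= a)%N.
Proof.
move=> a0; apply: dvdn_leq => //; rewrite big_mkcond/= -/(index_enum _).
have : uniq (index_enum S) by exact: index_enum_uniq.
elim: (index_enum S) => [_|x s IH /= /andP[xs us]]; first by rewrite big_nil dvd1n.
rewrite big_cons Gauss_dvd ?pfactor_dvdnn ?IH//.
rewrite coprime_sym; elim: s xs {us IH} => [|y s IH]; first by rewrite big_nil coprime1n.
rewrite inE negb_or big_cons coprimeMl => /andP[xy /IH ->]; rewrite andbT.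
rewrite coprimeXl// coprimeXr// prime_coprime ?(valP (val y))//.
rewrite dvdn_prime2 ?(valP (val y)) ?(valP (val x))// eq_sym.
by apply: contra xy => /eqP/val_inj/val_inj ->.
Qed.

Lemma exists_invXn_lt (F : archiRealFieldType) (p : nat) (e : F) :
  (1 < p)%N -> 0 < e -> exists k, (p%:R : F) ^- k < e.
Proof.
move=> p1 e0; exists (Num.bound e^-1).
have p0 : 0 < p%:R :> F by rewrite ltr0n ltnW.
rewrite invf_plt ?posrE ?exprn_gt0//.
apply: lt_le_trans (archi_boundP _) _; first by rewrite invr_ge0 ltW.
by rewrite -natrX ler_nat ltnW// ltn_expl.
Qed.

(** * Neighbourhoods and boxes in [QS] *)

Section PadicTopology.
Variable R : realType.

Lemma nbhs_padicP (q : primeNat) (x : padic q) (A : set (padic q)) :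
  nbhs x A <-> exists k, [set y | pnorm R (y - x) <= (val q)%:R ^- k] `<=` A.
Proof.
split=> [|[k kA]].
  move=> /nbhs_ballP[e /= e0 eA].
  have [k ke] := exists_invXn_lt (prime_val_gt1 q) e0.
  exists k => y /=; rewrite /pnorm -ratr_primeV ler_rat => xy; apply: eA.
  by rewrite ballEmdist /= /mdist/= /padic_dist -padic_normN opprB (le_lt_trans xy).
apply/nbhs_ballP; exists ((val q)%:R ^- k) => /=.
  by rewrite invr_gt0 exprn_gt0// ltr0n prime_val_gt0.
move=> y; rewrite ballEmdist/= /mdist/= /padic_dist => xy; apply: kA => /=.
by rewrite /pnorm -ratr_primeV ler_rat -padic_normN opprB ltW.
Qed.

Lemma pX_le (q : primeNat) (j k : nat) : (j <= k)%N ->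
  (val q)%:R ^- k <= (val q)%:R ^- j :> R.
Proof.
move=> jk; rewrite lef_pV2 ?posrE ?exprn_gt0 ?prime_valR_gt0//.
by rewrite ler_weXn2l// ltW// prime_valR_gt1.
Qed.

Lemma nbhs_rV_padicP (q : primeNat) d (x : 'rV[padic q]_d) (A : set _) :
  nbhs x A <-> exists k, [set y : 'rV_d |
    forall i, pnorm R (y 0 i - x 0 i) <= (val q)%:R ^- k] `<=` A.
Proof.
split=> [[P xP PA]|[k kA]].
  have /choice[k kP] : forall i : 'I_d, exists k : nat,
      [set y | pnorm R (y - x 0 i) <= (val q)%:R ^- k] `<=` P 0 i.
    by move=> i; apply/nbhs_padicP/xP.
  exists (\max_i k i)%N => y yk; apply: PA => i j; rewrite ord1; apply: kP => /=.
  by apply: le_trans (yk j) _; rewrite pX_le// leq_bigmax.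
exists (fun i j => [set y | pnorm R (y - x i j) <= (val q)%:R ^- k]).
  by move=> i j; apply/nbhs_padicP; exists k.
by move=> y yP; apply: kA => i; exact: yP.
Qed.

Variables (S : {fset primeNat}) (d : nat).

(** The radii vary with coordinate and place, because the sides of the approximation boxes R_b are
    governed by the different [tau i nu]. *)
Definition pbox (a : QS S d) (N : 'I_d -> S -> nat) : set (QS S d) :=
  [set x | forall i nu,
    pnorm R (x nu 0 i - a nu 0 i) <= (val (val nu))%:R ^- N i nu].

Lemma nbhs_QSP (x : QS S d) (V : set (QS S d)) :
  nbhs x V <-> exists k, pbox x (fun _ _ => k) `<=` V.
Proof.
split=> [xV|[k kV]].
  (* The product topology is a supremum over the places, so it suffices to compare the filter of
     cubes around [x] with the topology pulled back from each place. *)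
  pose F : set_system (QS S d) :=
    filter_from setT (fun k => pbox x (fun _ _ => k)).
  have FF : Filter F.
    apply: filter_from_filter; first by exists 0%N.
    move=> i j _ _; exists (maxn i j) => // y yb; split=> l nu.
      by apply: le_trans (yb l nu) _; rewrite pX_le// leq_maxl.
    by apply: le_trans (yb l nu) _; rewrite pX_le// leq_maxr.
  suff : F --> x by move=> /(_ _ xV)[k _ kV]; exists k.
  apply/cvg_sup => nu A [B [[C oC <-]] Cx BA].
  have [k kC] : exists k, [set y : 'rV_d | forall i,
      pnorm R (y 0 i - x nu 0 i) <= (val (val nu))%:R ^- k] `<=` C.
    by apply/nbhs_rV_padicP; apply: open_nbhs_nbhs; split.
  by exists k => // y yb; apply: BA; apply: kC => i; exact: yb.
pose P (nu : S) (y : QS S d) :=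
  forall i, pnorm R (y nu 0 i - x nu 0 i) <= (val (val nu))%:R ^- k.
have xP nu : nbhs x (P nu).
  have xx : nbhs x --> x by [].
  have : nbhs (x nu) [set y : 'rV_d | forall i,
      pnorm R (y 0 i - x nu 0 i) <= (val (val nu))%:R ^- k].
    by apply/nbhs_rV_padicP; exists k.
  rewrite nbhsE => -[C [oC Cx] CP]; move/cvg_sup : xx => /(_ nu); apply.
  exists ((fun f : QS S d => f nu) @^-1` C); split=> //; first by exists C.
  by move=> y Cy; exact: CP.
have {}xP : nbhs x [set y | forall nu, P nu y].
  exact: (@filter_forall _ _ P (nbhs x) _ xP).
by apply: (filterS _ xP) => y yb; apply: kV => i nu; exact: yb.
Qed.

Lemma pbox_trans a x y N : pbox a N x -> pbox x N y -> pbox a N y.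
Proof.
move=> ax xy i nu; rewrite -(subrKA (x nu 0 i)); apply: pnormD_le; last exact: ax.
exact: xy.
Qed.

Lemma pbox_sym x y N : pbox x N y -> pbox y N x.
Proof. by move=> xy i nu; rewrite -pnormN opprB. Qed.

Lemma pboxxx a N : pbox a N a.
Proof.
move=> i nu; rewrite subrr pnorm0 invr_ge0 exprn_ge0//.
Qed.

Lemma pbox_le a N N' : (forall i nu, (N i nu <= N' i nu)%N) -> pbox a N' `<=` pbox a N.
Proof. by move=> NN x xN i nu; apply: le_trans (xN i nu) _; rewrite pX_le. Qed.

Definition max_entry (N : 'I_d -> S -> nat) := (\max_i \max_nu N i nu)%N.

Lemma pbox_max_entry a N : pbox a (fun _ _ => max_entry N) `<=` pbox a N.
Proof.
apply: pbox_le => i nu; rewrite /max_entry.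
apply: leq_trans (leq_bigmax i); exact: (leq_bigmax nu).
Qed.

Lemma open_pbox_invariant k (A : set (QS S d)) :
  (forall x, A x -> pbox x (fun _ _ => k) `<=` A) -> open A.
Proof. by move=> Ak; rewrite openE => x Ax; apply/nbhs_QSP; exists k; exact: Ak. Qed.

Lemma open_pbox a N : open (pbox a N).
Proof.
apply: (@open_pbox_invariant (max_entry N)) => x ax y /pbox_max_entry.
exact: pbox_trans.
Qed.

(** Cubes of one size partition the space, so the complement of a union of such cubes is again one.
    With [open_pbox_invariant] these unions are clopen. *)
Lemma open_setC_pbox_invariant k (A : set (QS S d)) :
  (forall x, A x -> pbox x (fun _ _ => k) `<=` A) -> open (~` A).
Proof.
move=> Ak; apply: (@open_pbox_invariant k) => x nAx y xy Ay; apply: nAx.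
exact: Ak Ay _ (pbox_sym xy).
Qed.

End PadicTopology.

(** * Haar measure and coverings by eccentric boxes *)

Section HaarCovering.
Import numFieldNormedType.Exports.
Variables (R : realType) (S : {fset primeNat}) (d : nat).
Variable mu : {measure set (QS_borel S d) -> \bar R}.
Hypothesis mu_haar : is_haar mu.
Local Notation pbox := (@pbox R S d).

Lemma open_measurable_QS (A : set (QS S d)) :
  open A -> measurable (A : set (QS_borel S d)).
Proof. by move=> oA; apply: sub_sigma_algebra. Qed.

Definition QS_opp (a : QS S d) : QS S d := fun nu => - a nu.

Lemma QS_addK (a : QS S d) : cancel (QS_add a) (QS_add (QS_opp a)).
Proof.
move=> x; apply: functional_extensionality_dep => nu.
by rewrite /QS_add /QS_opp addKr.
Qed.

Lemma QS_addNK (a : QS S d) : cancel (QS_add (QS_opp a)) (QS_add a).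
Proof.
move=> x; apply: functional_extensionality_dep => nu.
by rewrite /QS_add /QS_opp addNKr.
Qed.

Lemma measurable_QS_add (a : QS S d) (A : set (QS_borel S d)) :
  measurable A -> measurable (QS_add a @` A : set (QS_borel S d)).
Proof.
move=> mA; have -> : QS_add a @` A = setT `&` QS_add (QS_opp a) @^-1` A.
  apply/seteqP; split=> [_ [x Ax <-]|x [_ Ax]]; first by split=> //=; rewrite QS_addK.
  by exists (QS_add (QS_opp a) x) => //; rewrite QS_addNK.
have mf : measurable_fun [set: QS_borel S d]
    (QS_add (QS_opp a) : QS_borel S d -> QS_borel S d).
  apply: (@measurability _ _ (QS_borel S d) (QS_borel S d) setT
    (QS_add (QS_opp a)) (@open (QS S d)) erefl) => _ [C oC <-].
  apply: open_measurable_QS; rewrite setTI openE => x Cx.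
  have /(nbhs_QSP R)[k kC] : nbhs (QS_add (QS_opp a) x) C.
    exact: open_nbhs_nbhs.
  apply/(nbhs_QSP R); exists k => y xy; apply: kC => i nu.
  rewrite /QS_add !mxE opprD addrACA subrr add0r; exact: xy.
exact: mf.
Qed.

Section OneCoordinate.
Variables (I : Type) (a : I -> QS S d) (N : I -> 'I_d -> S -> nat).
Variables (i0 : 'I_d) (nu0 : S) (K : nat).
Let p := val (val nu0).
Let e (i : 'I_d) (nu : S) := (i == i0) && (nu == nu0).

Definition refine_at (j : I) (i : 'I_d) (nu : S) :=
  (N j i nu + if (i == i0) && (nu == nu0) then K else 0)%N.

(** Boxes are grouped by their exponent [n] in the chosen coordinate [(i0, nu0)]. [P n] is the part
    of group [n] outside all groups of smaller exponent, that is, of larger side there. *)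
Let O n : set (QS S d) :=
  \bigcup_(j in [set j | N j i0 nu0 = n]) pbox (a j) (N j).
Let O' n : set (QS S d) :=
  \bigcup_(j in [set j | N j i0 nu0 = n]) pbox (a j) (refine_at j).
Let P : nat -> set (QS S d) := seqDU O.
Let P' n := O' n `&` P n.
Let shift n u : QS S d := fun nu =>
  \row_i if e i nu then u%:R * (val (val nu))%:R ^+ n else 0.

Let near n (x y : QS S d) := forall i nu, pnorm R (y nu 0 i - x nu 0 i) <=
  if e i nu then (val (val nu))%:R ^- n else 0.

Let near_sym n x y : near n x y -> near n y x.
Proof. by move=> xy i nu; rewrite -pnormN opprB. Qed.

(** Boxes in [O k] have side [p ^- k >= p ^- n] in the chosen coordinate, and [near n] fixes all
    other coordinates. Hence each [P n] is invariant under such moves. *)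
Let O_near n k x y : (k <= n)%N -> O k x -> near n x y -> O k y.
Proof.
move=> kn [j /= jk xj] xy; exists j => //= i nu.
rewrite -(subrKA (x nu 0 i)); apply: pnormD_le; last exact: xj.
apply: le_trans (xy i nu) _; rewrite /e; case: ifP => [/andP[/eqP -> /eqP ->]|_].
  by rewrite pX_le// jk.
by rewrite invr_ge0 exprn_ge0.
Qed.

Let P_near n x y : P n x -> near n x y -> P n y.
Proof.
rewrite /P /seqDU -!bigcup_mkord => -[On nO] xy; split; first exact: O_near On xy.
move=> [k /= kn Ok]; apply: nO; exists k => //.
by apply: O_near Ok (near_sym xy); exact: ltnW.
Qed.

(** Subtracting a suitable [u p ^ n] in the chosen coordinate moves a point of a box into the
    refined box, and the point stays in [P n] by invariance. *)
Let P_cover n : P n `<=` \big[setU/set0]_(u < (p ^ K)%N) (QS_add (shift n u) @` P' n).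
Proof.
move=> x Px; have [[j /= jn xj] _] := Px.
have := xj i0 nu0; rewrite jn => /(pnorm_approx K)[u uK xu].
rewrite -(bigcup_mkord _ (fun u => QS_add (shift n u) @` P' n)); exists u => //=.
pose y : QS S d := fun nu => x nu - shift n u nu.
have xy : near n x y.
  move=> i nu; rewrite /y !mxE addrAC subrr add0r pnormN.
  case: ifP => [_|]; last by rewrite pnorm0.
  rewrite pnormM pnorm_primeX -[leRHS]mul1r ler_wpM2r ?invr_ge0 ?exprn_ge0//.
  by have := @pnorm_int_le1 R (val nu) u; rewrite -pmulrn.
exists y; last first.
  by apply: functional_extensionality_dep => nu; rewrite /QS_add /y addrC subrK.
split; last exact: P_near Px xy.
exists j => //= i nu; rewrite /refine_at /y !mxE.
rewrite /e; case: ifP => [/andP[/eqP -> /eqP ->]|_].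
  by rewrite addrAC jn.
by rewrite subr0 addn0.
Qed.

Let mO n : measurable (O n : set (QS_borel S d)).
Proof. by apply: open_measurable_QS; apply: bigcup_open => j _; exact: open_pbox. Qed.

Let mO' n : measurable (O' n : set (QS_borel S d)).
Proof. by apply: open_measurable_QS; apply: bigcup_open => j _; exact: open_pbox. Qed.

Let mP n : measurable (P n : set (QS_borel S d)).
Proof. exact: seqDU_measurable. Qed.

Let mP' n : measurable (P' n : set (QS_borel S d)).
Proof. exact: measurableI. Qed.

Let muP n : (mu (P n) <= (p ^ K)%N%:R%:E * mu (P' n))%E.
Proof.
have mS u : measurable (QS_add (shift n u) @` P' n : set (QS_borel S d)).
  exact: measurable_QS_add.
have := @content_subadditive _ _ _ mu (P n) (fun u => QS_add (shift n u) @` P' n)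
  (p ^ K)%N (fun u _ => mS u) (mP n) (@P_cover n).
move=> /le_trans; apply.
rewrite (eq_bigr (fun=> mu (P' n))) => [|u _]; last exact: mu_haar.2.
elim: (p ^ K)%N => [|k IH]; first by rewrite big_ord0 mul0e.
by rewrite big_ord_recr/= -natr1 EFinD ge0_muleDl// mul1e leeD2r.
Qed.

(** The [P n] partition the union and the [P' n] are disjoint subsets of the refined union, so [muP]
    can be summed over [n] however the boxes overlap. *)
Lemma haar_refine_at :
  (mu (\bigcup_j pbox (a j) (N j)) <=
  (val (val nu0) ^ K)%N%:R%:E * mu (\bigcup_j pbox (a j) (refine_at j)))%E.
Proof.
have -> : \bigcup_j pbox (a j) (N j) = \bigcup_n O n.
  apply/seteqP; split=> x; first by move=> [j _ xj]; exists (N j i0 nu0) => //; exists j.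
  by move=> [n _ [j _ xj]]; exists j.
have -> : \bigcup_j pbox (a j) (refine_at j) = \bigcup_n O' n.
  apply/seteqP; split=> x; first by move=> [j _ xj]; exists (N j i0 nu0) => //; exists j.
  by move=> [n _ [j _ xj]]; exists j.
have mUP' : measurable (\bigcup_n P' n : set (QS_borel S d)).
  exact: bigcupT_measurable.
rewrite seqDU_bigcup_eq -/P measure_semi_bigcup//; last 2 first.
  exact: trivIset_seqDU.
  exact: bigcupT_measurable.
apply: le_trans (lee_nneseries (fun n _ _ => measure_ge0 mu (P n)) (fun n _ => muP n)) _.
rewrite nneseriesZl//.
apply: lee_wpmul2l; first by rewrite lee_fin.
rewrite -measure_semi_bigcup//.
  apply: le_measure; rewrite ?inE//; first exact: bigcupT_measurable.
  by apply: subset_bigcup => n _ x [].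
apply/trivIsetP => i j _ _ ij; apply/seteqP; split=> // x [[_ xi] [_ xj]].
have /trivIsetP/(_ i j Logic.I Logic.I ij) := trivIset_seqDU O.
by move/seteqP => [+ _] => /(_ x); apply.
Qed.

End OneCoordinate.

(** One coordinate at one place is refined at a time and the factors multiply. They do not depend on
    the radii [N], so eccentricity costs nothing. *)
Lemma haar_shrink (I : Type) (a : I -> QS S d) (N : I -> 'I_d -> S -> nat) (K : nat) :
  (mu (\bigcup_j pbox (a j) (N j)) <=
   (\prod_(c : 'I_d * S) val (val c.2) ^ K)%N%:R%:E *
     mu (\bigcup_j pbox (a j) (fun i nu => N j i nu + K)%N))%E.
Proof.
(* [Ns s] refines a coordinate as often as it occurs in [s]; in the full enumeration each occurs
   once. *)
pose Ns (s : seq ('I_d * S)%type) j i nu := (N j i nu + count_mem (i, nu) s * K)%N.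
suff H s : (mu (\bigcup_j pbox (a j) (N j)) <=
    (\prod_(c <- s) val (val c.2) ^ K)%N%:R%:E * mu (\bigcup_j pbox (a j) (Ns s j)))%E.
  have := H (index_enum _); congr (_ <= _ * mu _)%E.
  apply: eq_bigcupr => j _; congr pbox; apply/funext => i; apply/funext => nu.
  by rewrite /Ns count_uniq_mem ?index_enum_uniq// mem_index_enum mul1n.
elim: s => [|c s IH].
  rewrite big_nil mul1e; set X := mu _; set Y := mu _; suff -> : X = Y by [].
  congr (mu _); apply: eq_bigcupr => j _; congr pbox.
  by apply/funext => i; apply/funext => nu; rewrite /Ns /= mul0n addn0.
apply: le_trans IH _; rewrite big_cons mulnC natrM EFinM -muleA.
apply: lee_wpmul2l; first by rewrite lee_fin.
apply: le_trans (haar_refine_at a (Ns s) c.1 c.2 K) _.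
apply: lee_wpmul2l; first by rewrite lee_fin.
set X := mu _; set Y := mu _; suff -> : X = Y by [].
congr (mu _); apply: eq_bigcupr => j _; congr pbox.
apply/funext => i; apply/funext => nu; rewrite /refine_at /Ns /=.
rewrite -addnA; congr addn; rewrite mulnDl addnC; congr addn.
rewrite (_ : (c == (i, nu)) = (i == c.1) && (nu == c.2)).
  by case: ifP; rewrite ?mul1n ?mul0n.
by clear; case: c => c1 c2; rewrite xpair_eqE (eq_sym i) (eq_sym nu).
Qed.

(** By [haar_shrink] the sub-boxes missing [E] fill a fixed proportion of the union of the boxes
    inside [V]. Removing a good part of them leaves an open set around [E] of measure at most [th]
    times that of [V]; iteration from [ZS] gives measures tending to 0. *)
Lemma haar_negligible (E : set (QS S d)) (K : nat) : E `<=` @ZS S d ->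
  (forall x, E x -> forall V, open V -> V x -> exists a N,
    [/\ pbox a N x, pbox a N `<=` V &
        pbox a (fun i nu => N i nu + K)%N `&` E = set0]) ->
  mu.-negligible (E : set (QS_borel S d)).
Proof.
move=> EZ EK; set M := (\prod_(c : 'I_d * S) val (val c.2) ^ K)%N.
have M0 : (0 < M)%N.
  by apply: prodn_gt0 => c; rewrite expn_gt0 prime_val_gt0.
(* The sub-boxes fill at least [1 / M] of the union. Half of this is given up in order to remove
   only a clopen set, so that what remains is open. *)
pose th : R := 1 - (2 * M%:R)^-1.
have th_lt1 : th < 1 by rewrite /th ltrBlDr ltrDl invr_gt0 mulr_gt0// ltr0n.
have th0 : 0 <= th.
  rewrite /th subr_ge0 invf_le1 ?mulr_gt0 ?ltr0n//.
  by rewrite -natrM ler1n muln_gt0.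
have oZ : open (@ZS S d).
  have -> : @ZS S d = pbox (fun=> 0) (fun _ _ => 0%N).
    apply/seteqP; split=> x xZ; [move=> i nu|move=> nu i].
      by rewrite mxE subr0 expr0 invr1 -(rmorph1 (@ratr R)) /pnorm ler_rat; exact: xZ.
    have := xZ i nu; rewrite mxE subr0 expr0 invr1.
    by rewrite -(rmorph1 (@ratr R)) /pnorm ler_rat.
  exact: open_pbox.
have step (V : set (QS S d)) : open V -> E `<=` V -> (mu V < +oo)%E ->
    exists V', [/\ open V', E `<=` V' & (mu V' <= th%:E * mu V)%E].
  move=> oV EV muV.
  have mV : measurable (V : set (QS_borel S d)) by exact: open_measurable_QS.
  pose I := {c : QS S d * ('I_d -> S -> nat) | pbox c.1 c.2 `<=` V /\
    pbox c.1 (fun i nu => c.2 i nu + K)%N `&` E = set0}.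
  pose O := \bigcup_(j : I) pbox (sval j).1 (sval j).2.
  pose O' := \bigcup_(j : I) pbox (sval j).1 (fun i nu => (sval j).2 i nu + K)%N.
  have muOM : (mu O <= M%:R%:E * mu O')%E.
    exact: (haar_shrink (fun j : I => (sval j).1) (fun j : I => (sval j).2)).
  have oO : open O by apply: bigcup_open => j _; exact: open_pbox.
  have oO' : open O' by apply: bigcup_open => j _; exact: open_pbox.
  have OV : O `<=` V by move=> x [[c [cV ?]] _ /=]; exact: cV.
  have O'O : O' `<=` O.
    move=> x [j _ xj]; exists j => //; apply: pbox_le xj => i nu.
    exact: leq_addr.
  have EO : E `<=` O.
    move=> x Ex; have [a [N [xa aV aE]]] := EK x Ex V oV (EV _ Ex).
    by exists (exist _ (a, N) (conj aV aE)).
  have EO' x : E x -> ~ O' x.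
    move=> Ex [[c [? cE]] _ /= xc].
    by have : set0 x by rewrite -cE.
  have mO : measurable (O : set (QS_borel S d)) by exact: open_measurable_QS.
  have mO' : measurable (O' : set (QS_borel S d)) by exact: open_measurable_QS.
  have muO : (mu O < +oo)%E by apply: le_lt_trans muV; rewrite le_measure ?inE.
  (* exhaust O' by sets which are unions of boxes of a fixed size, hence clopen *)
  pose C k : set (QS S d) := [set x | pbox x (fun _ _ => k) `<=` O'].
  have Ck k x : C k x -> pbox x (fun _ _ => k) `<=` C k.
    by move=> Cx y xy z yz; apply: Cx; exact: pbox_trans xy yz.
  have oC k : open (C k) := open_pbox_invariant (Ck k).
  have CO' k : C k `<=` O' by move=> x; apply; exact: pboxxx.
  have mC k : measurable (C k : set (QS_borel S d)) by exact: open_measurable_QS.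
  have UC : \bigcup_k C k = O'.
    apply/seteqP; split=> x; first by move=> [k _]; exact: CO'.
    move=> O'x; have /(nbhs_QSP R)[k kO'] : nbhs x O' by exact: open_nbhs_nbhs.
    by exists k.
  (* Continuity of the measure from below along the [C k]. It needs the strict bound
     [mu O / (2 M) < mu O'], hence the separate case [mu O = 0]. *)
  have [k muk] : exists k, ((2 * M%:R)^-1%:E * mu O <= mu (C k))%E.
    have [muO0|muO0] := eqVneq (mu O) 0%E.
      by exists 0%N; rewrite muO0 mule0.
    have O0 : (0 < mu O)%E by rewrite lt0e muO0 measure_ge0.
    have cvC : mu \o C @ \oo --> mu O'.
      rewrite -UC; apply: nondecreasing_cvg_mu => //; first by rewrite UC.
      move=> i j ij; apply/subsetPset => x Cx; apply: subset_trans Cx.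
      by apply: pbox_le.
    have ltO : ((2 * M%:R)^-1%:E * mu O < mu O')%E.
      have O'fin : mu O' \is a fin_num.
        rewrite ge0_fin_numE ?measure_ge0//; apply: le_lt_trans muO.
        by rewrite le_measure ?inE.
      have finO : mu O \is a fin_num by rewrite ge0_fin_numE ?measure_ge0.
      move: muOM O0; rewrite -(fineK O'fin) -(fineK finO) -!EFinM lee_fin !lte_fin.
      move=> OM O0; rewrite mulrC ltr_pdivrMr ?mulr_gt0 ?ltr0n// mulrCA [_ * M%:R]mulrC.
      by lra.
    have [k _ kC] := cvC _ (open_ereal_gt_ereal ltO).
    by exists k; apply: ltW; exact: (kC k (leqnn k)).
  exists (O `\` C k); split.
  - by rewrite setDE; apply: openI => //; exact: open_setC_pbox_invariant (Ck k).
  - by move=> x Ex; split; [exact: EO|move=> /CO'; exact: EO'].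
  have finO : mu O \is a fin_num by rewrite ge0_fin_numE ?measure_ge0.
  rewrite measureD// setIidr; last by apply: subset_trans O'O; exact: CO'.
  apply: (@le_trans _ _ (th%:E * mu O)%E); last first.
    by apply: lee_wpmul2l; rewrite ?lee_fin// le_measure ?inE.
  have -> : (th%:E * mu O = mu O - (2 * M%:R)^-1%:E * mu O)%E.
    by rewrite -(fineK finO) -!EFinM -EFinB /th mulrBl mul1r.
  exact: leeB.
have Vk k : exists V, [/\ open V, E `<=` V & (mu V <= (th ^+ k)%:E)%E].
  elim: k => [|k [V [oV EV muV]]].
    by exists (@ZS S d); split=> //; rewrite expr0; have [-> _] := mu_haar.
  have [|V' [oV' EV' muV']] := step V oV EV; first by rewrite (le_lt_trans muV)// ltry.
  exists V'; split=> //; apply: le_trans muV' _.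
  by rewrite exprS EFinM; apply: lee_wpmul2l; rewrite ?lee_fin.
have /choice[V VP] := Vk.
have mV k : measurable (V k : set (QS_borel S d)).
  by apply: open_measurable_QS; have [] := VP k.
exists (\bigcap_k V k); split.
- exact: bigcapT_measurable.
- apply/eqP; rewrite eq_le measure_ge0 andbT; apply/lee_addgt0Pr => e e0.
  rewrite add0e.
  have cv : (fun k => th ^+ k) @ \oo --> (0 : R) by apply: cvg_expr; rewrite ger0_norm.
  have [k _ ke] := cvgr_lt _ cv e e0.
  have [_ _ muVk] := VP k.
  apply: le_trans (_ : mu (V k) <= _)%E; last first.
    by apply: le_trans muVk _; rewrite lee_fin ltW//; exact: (ke k (leqnn k)).
  apply: le_measure; rewrite ?inE//; first exact: bigcapT_measurable.
  exact: bigcap_inf.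
- by move=> x Ex k _; have [_ + _] := VP k; apply.
Qed.

End HaarCovering.

(** * Second order Taylor expansion from difference quotients *)

Section Taylor.
Variables (R : realType) (q : primeNat) (d : nat).
Local Notation K := (padic q).
Local Notation pn := (@pnorm R q).
Local Notation p := (val q).

Definition rV_pball k (a : 'rV[K]_d) : set 'rV[K]_d :=
  [set x | forall i, pn (x 0 i - a 0 i) <= p%:R ^- k].

Lemma set_coord_id (x : 'rV[K]_d) i : set_coord x i (x 0 i) = x.
Proof. by apply/rowP => j; rewrite mxE; case: eqVneq => [->|]. Qed.

Lemma set_coordK (x : 'rV[K]_d) i s t :
  set_coord (set_coord x i s) i t = set_coord x i t.
Proof. by apply/rowP => j; rewrite !mxE; case: eqP. Qed.

(** The path through the points [w l], with the first [l] coordinates from [x] and the others from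
    [b], changes one coordinate at a time. The ultrametric inequality bounds the total by the
    largest step, without a factor [d]. *)
Lemma pnorm_pathB_le (h : 'rV[K]_d -> K) (x b : 'rV[K]_d) (e : R) : 0 <= e ->
  (forall (i : 'I_d) (y : 'rV[K]_d), y 0 i = x 0 i ->
     (forall j, y 0 j = x 0 j \/ y 0 j = b 0 j) ->
     pn (h y - h (set_coord y i (b 0 i))) <= e) ->
  pn (h x - h b) <= e.
Proof.
move=> e0 he.
pose w l : 'rV[K]_d := \row_j (if (j < l)%N then x 0 j else b 0 j).
have -> : x = w d by apply/rowP => j; rewrite mxE ltn_ord.
have H l : (l <= d)%N -> pn (h (w l) - h b) <= e.
  elim: l => [_|l IH ld].
    have -> : w 0%N = b by apply/rowP => j; rewrite mxE ltn0.
    by rewrite subrr pnorm0.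
  rewrite -(subrKA (h (w l))); apply: pnormD_le; last exact: IH (ltnW ld).
  have -> : w l = set_coord (w l.+1) (Ordinal ld) (b 0 (Ordinal ld)).
    apply/rowP => j; rewrite !mxE ltnS (leq_eqVlt j l).
    by case: (eqVneq j (Ordinal ld)) => [->|] /=; rewrite ?ltnn//;
      rewrite -val_eqE/= => /negbTE ->.
  by apply: he => [|j]; rewrite mxE ?ltnSn//; case: ifP; [left|right].
exact: H.
Qed.

Section Core.
Variables (g : 'rV[K]_d -> K) (a : 'rV[K]_d) (D : 'rV[K]_d) (k : nat) (B : R).
Hypothesis B_gt0 : 0 < B.
Hypothesis second_bounded : forall (i j : 'I_d) (x : 'rV[K]_d) s t,
  rV_pball k a x -> pn (s - a 0 i) <= p%:R ^- k -> pn (t - a 0 j) <= p%:R ^- k ->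
  x 0 i != s -> x 0 j != t -> (i = j -> s != t) ->
  pn (diff_quot i s (diff_quot j t g) x) <= B.
Hypothesis first_cvg : forall (j : 'I_d) (e : R), 0 < e -> exists k', forall s : K,
  s != a 0 j -> pn (s - a 0 j) <= p%:R ^- k' ->
  pn (diff_quot j (a 0 j) g (set_coord a j s) - D 0 j) <= e.

Let aa i : pn (a 0 i - a 0 i) <= p%:R ^- k.
Proof. by rewrite subrr pnorm0 invr_ge0 exprn_ge0. Qed.

(** Along the coordinate path from [a] to [x], the step in coordinate [j] is [x_j - a_j] times a
    first difference quotient. That quotient differs from [D_j] by at most [B rho], since its own
    increments are second difference quotients times lengths at most [rho]. *)
Lemma taylor_core (x : 'rV[K]_d) (rho : R) :
  (forall i, pn (x 0 i - a 0 i) <= rho) -> 0 <= rho -> rho <= p%:R ^- k ->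
  pn (g x - g a - \sum_i D 0 i * (x 0 i - a 0 i)) <= B * rho ^+ 2.
Proof.
move=> xr rho0 rhok.
have xk i : pn (x 0 i - a 0 i) <= p%:R ^- k by exact: le_trans (xr i) rhok.
have lip (j : 'I_d) (y : 'rV[K]_d) : y 0 j = x 0 j -> x 0 j != a 0 j ->
    (forall l, y 0 l = x 0 l \/ y 0 l = a 0 l) ->
    pn (diff_quot j (a 0 j) g y - D 0 j) <= B * rho.
  move=> yj xj yl; set h := diff_quot j (a 0 j) g.
  have yk : rV_pball k a y by move=> i; case: (yl i) => ->.
  have rho_gt0 : 0 < rho.
    apply: lt_le_trans (xr j); rewrite lt_neqAle pnorm_ge0 andbT eq_sym.
    by rewrite pnorm_eq0 subr_eq0.
  have Brho : 0 < B * rho by rewrite mulr_gt0.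
  have [k' k'P] := first_cvg j Brho.
  have [k2 k2P] := exists_invXn_lt (prime_val_gt1 q) rho_gt0.
  have xja : 0 < pn (x 0 j - a 0 j).
    by rewrite lt_neqAle pnorm_ge0 andbT eq_sym pnorm_eq0 subr_eq0.
  have [k3 k3P] := exists_invXn_lt (prime_val_gt1 q) xja.
  (* Second quotients in one coordinate need three distinct points, so [s] is an auxiliary point
     different from [a_j] and [x_j]. It is so close to [a_j] that [first_cvg] applies and
     [|x_j - s| <= rho]. *)
  pose M := maxn k' (maxn k2 (maxn k3 k)); pose s : K := a 0 j + p%:R ^+ M.
  have sa : pn (s - a 0 j) = p%:R ^- M by rewrite addrAC subrr add0r pnorm_primeX.
  have sNa : s != a 0 j.
    rewrite -subr_eq0 -(pnorm_eq0 R) sa invr_eq0 expf_neq0//.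
    by rewrite gt_eqF// prime_valR_gt0.
  have sNx : x 0 j != s.
    apply: contraTneq k3P => xs; rewrite -leNgt xs sa pX_le//.
    by rewrite !leq_max leqnn !orbT.
  have sk : pn (s - a 0 j) <= p%:R ^- k by rewrite sa pX_le// !leq_max leqnn !orbT.
  (* The other coordinates are moved to those of [a], keeping coordinate [j] at [x_j]. *)
  have step1 : pn (h y - h (set_coord a j (x 0 j))) <= B * rho.
    apply: pnorm_pathB_le => [|i z zi zl]; first exact: ltW.
    have [->|ij] := eqVneq i j.
      rewrite mxE eqxx.
      have -> : x 0 j = z 0 j by case: (zl j) => ->; rewrite ?yj// mxE eqxx.
      by rewrite set_coord_id subrr pnorm0 ltW.
    rewrite mxE (negbTE ij).
    have [yia|yia] := eqVneq (y 0 i) (a 0 i).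
      have -> : a 0 i = z 0 i by rewrite zi.
      by rewrite set_coord_id subrr pnorm0 ltW.
    have zk : rV_pball k a z.
      move=> l; case: (zl l) => ->; first exact: yk.
      by rewrite mxE; case: eqP => [->|].
    have zj : z 0 j != a 0 j by case: (zl j) => ->; rewrite ?yj// mxE eqxx.
    have := second_bounded zk (aa i) (aa j) _ zj.
    rewrite zi => /(_ yia) H; have {}H : pn (diff_quot i (a 0 i) h z) <= B.
      by apply: H => ijE; rewrite ijE eqxx in ij.
    have zia : z 0 i - a 0 i != 0 by rewrite zi subr_eq0.
    have -> : h z - h (set_coord z i (a 0 i)) =
        diff_quot i (a 0 i) h z * (z 0 i - a 0 i) by rewrite divfK.
    rewrite pnormM ler_pM ?pnorm_ge0// zi.
    by case: (yl i) => ->; rewrite ?subrr ?pnorm0.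
  (* Now coordinate [j] moves from [x_j] to [s], where the limit takes over. *)
  have step2 : pn (h (set_coord a j (x 0 j)) - h (set_coord a j s)) <= B * rho.
    have zk : rV_pball k a (set_coord a j (x 0 j)).
      by move=> l; rewrite mxE; case: eqP => [->|].
    have := second_bounded zk sk (aa j); rewrite !mxE eqxx => /(_ sNx xj) H.
    have xs0 : x 0 j - s != 0 by rewrite subr_eq0.
    have -> : h (set_coord a j (x 0 j)) - h (set_coord a j s) =
        diff_quot j s h (set_coord a j (x 0 j)) * (x 0 j - s).
      by rewrite /diff_quot set_coordK mxE eqxx divfK.
    rewrite pnormM ler_pM ?pnorm_ge0 ?H//.
    rewrite -(subrKA (a 0 j)); apply: pnormD_le; first exact: xr.
    rewrite -pnormN opprB sa ltW//; apply: le_lt_trans k2P.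
    by rewrite pX_le// !leq_max leqnn !orbT.
  have step3 : pn (h (set_coord a j s) - D 0 j) <= B * rho.
    by apply: k'P => //; rewrite sa pX_le// leq_maxl.
  rewrite -(subrKA (h (set_coord a j (x 0 j)))); apply: pnormD_le => //.
  by rewrite -(subrKA (h (set_coord a j s))); apply: pnormD_le.
pose G (y : 'rV[K]_d) := g y - \sum_i D 0 i * (y 0 i - a 0 i).
have -> : g x - g a - \sum_i D 0 i * (x 0 i - a 0 i) = G x - G a.
  rewrite /G [X in _ - (_ - X)]big1 ?subr0 1?addrAC// => i _.
  by rewrite subrr mulr0.
apply: pnorm_pathB_le => [|j y yj yl]; first by rewrite mulr_ge0 ?exprn_ge0// ltW.
have -> : G y - G (set_coord y j (a 0 j)) =
    g y - g (set_coord y j (a 0 j)) - D 0 j * (x 0 j - a 0 j).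
  have E : \sum_i D 0 i * (y 0 i - a 0 i) =
      \sum_i D 0 i * (set_coord y j (a 0 j) 0 i - a 0 i) +
      D 0 j * (x 0 j - a 0 j).
    rewrite (bigD1 j)//= [in RHS](bigD1 j)//= mxE eqxx subrr mulr0 add0r yj addrC.
    by congr (_ + _); apply: eq_bigr => i ij; rewrite mxE (negbTE ij).
  by rewrite /G E; ring.
have [xj|xj] := eqVneq (x 0 j) (a 0 j).
  have -> : a 0 j = y 0 j by rewrite yj.
  rewrite set_coord_id yj !subrr mulr0 subrr pnorm0.
  by rewrite mulr_ge0 ?exprn_ge0// ltW.
have xj0 : y 0 j - a 0 j != 0 by rewrite yj subr_eq0.
have -> : g y - g (set_coord y j (a 0 j)) - D 0 j * (x 0 j - a 0 j) =
    (diff_quot j (a 0 j) g y - D 0 j) * (x 0 j - a 0 j).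
  by rewrite mulrBl -{2}yj divfK.
by rewrite pnormM expr2 mulrA ler_pM ?pnorm_ge0//; exact: lip.
Qed.

End Core.

Lemma nat_bound (B : R) : exists n, B <= n%:R.
Proof.
exists (Num.bound `|B|); apply: le_trans (ler_norm _) _.
by apply: ltW; apply: archi_boundP.
Qed.

(** The continuous extensions provide what [taylor_core] assumes: the values of the first order ones
    on the diagonal form the differential, and the second order ones are bounded near the diagonal
    point by continuity. *)
Lemma C2_on_box_taylor (X : 'I_d -> set K) (g : 'rV[K]_d -> K) (a : 'rV[K]_d) :
  (forall i, open (X i)) -> box X a -> C2_on_box X g ->
  exists (D : 'rV[K]_d) (L : nat), forall (x : 'rV[K]_d) (rho : R),
    (forall i, pn (x 0 i - a 0 i) <= rho) -> 0 <= rho -> rho <= p%:R ^- L ->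
    pn (g x - g a - \sum_i D 0 i * (x 0 i - a 0 i)) <= L%:R * rho ^+ 2.
Proof.
move=> oX Xa [_ C1 C2].
have /choice[k0 k0P] : forall i, exists k, [set s | pn (s - a 0 i) <= p%:R ^- k] `<=` X i.
  by move=> i; apply/nbhs_padicP; apply: open_nbhs_nbhs; split.
pose k1 := (\max_i k0 i)%N.
have k1P i s k : (k1 <= k)%N -> pn (s - a 0 i) <= p%:R ^- k -> X i s.
  move=> k1k sk; apply: k0P; apply: le_trans sk _; rewrite pX_le//.
  by apply: leq_trans k1k; exact: leq_bigmax.
have /choice[g1 g1P] := C1.
have D1 j : (box X `*` X j) (a, a 0 j) by split=> //; exact: Xa.
pose D : 'rV[K]_d := \row_j g1 j (a, a 0 j).
have first (j : 'I_d) (e : R) : 0 < e -> exists k', forall s : K,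
    s != a 0 j -> pn (s - a 0 j) <= p%:R ^- k' ->
    pn (diff_quot j (a 0 j) g (set_coord a j s) - D 0 j) <= e.
  move=> e0; have [ke keP] := exists_invXn_lt (prime_val_gt1 q) e0.
  have [/subspace_continuousP/(_ _ (D1 j)) cg1 eg1] := g1P j.
  have : nbhs (g1 j (a, a 0 j)) [set w | pn (w - g1 j (a, a 0 j)) <= p%:R ^- ke].
    by apply/(nbhs_padicP R); exists ke.
  move=> /cg1 [[P Q] /= [/(nbhs_rV_padicP R)[k2 k2P] /(nbhs_padicP R)[k3 k3P]] PQ].
  exists (maxn k1 (maxn k2 k3)) => s sNa sk.
  have aw : forall i, pn (set_coord a j s 0 i - a 0 i) <=
      p%:R ^- maxn k1 (maxn k2 k3).
    move=> i; rewrite mxE; case: eqP => [->//|_].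
    by rewrite subrr pnorm0 invr_ge0 exprn_ge0.
  have Dz : (box X `*` X j) (set_coord a j s, a 0 j).
    split=> /=; last exact: Xa.
    by move=> i; apply: k1P (aw i); exact: leq_maxl.
  have := PQ (set_coord a j s, a 0 j); rewrite /= => /(_ _ Dz) H.
  have := eg1 (set_coord a j s, a 0 j); rewrite inE => /(_ _)/= <-.
    rewrite /D mxE; apply: le_trans (ltW keP); apply: H; split.
      apply: k2P => i /=; apply: le_trans (aw i) _.
      by rewrite pX_le// !leq_max leqnn !orbT.
    by apply: k3P; rewrite /= subrr pnorm0 invr_ge0 exprn_ge0.
  by split=> //=; rewrite mxE eqxx.
have second (c : 'I_d * 'I_d) : exists n : nat, forall (x : 'rV[K]_d) s t,
    rV_pball n a x -> pn (s - a 0 c.1) <= p%:R ^- n ->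
    pn (t - a 0 c.2) <= p%:R ^- n ->
    x 0 c.1 != s -> x 0 c.2 != t -> (c.1 = c.2 -> s != t) ->
    pn (diff_quot c.1 s (diff_quot c.2 t g) x) <= n%:R.
  case: c => i j /=; have [g2 [/subspace_continuousP cg2 eg2]] := C2 i j.
  pose z0 := (a, a 0 i, a 0 j).
  have D2 : (box X `*` X i `*` X j) z0 by split; first split; exact: Xa.
  have : nbhs (g2 z0) [set w | pn (w - g2 z0) <= p%:R ^- 0].
    by apply/(nbhs_padicP R); exists 0%N.
  move=> /(cg2 _ D2)[[P Q] /= [[[P1 P2] /= [/(nbhs_rV_padicP R)[k2 k2P]
    /(nbhs_padicP R)[k3 k3P]] P12] /(nbhs_padicP R)[k4 k4P]] PQ].
  (* Within distance 1 of [g2 z0] the norm is at most the maximum of 1 and [|g2 z0|]. *)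
  have [n nP] := nat_bound (Num.max 1 (pn (g2 z0))).
  pose M := maxn n (maxn k1 (maxn k2 (maxn k3 k4))); exists M => x s t xM sM tM xs xt st.
  have Dz : (box X `*` X i `*` X j) (x, s, t).
    split; [split=> /=|] => /=.
    - by move=> l; apply: k1P (xM l); rewrite !leq_max leqnn !orbT.
    - by apply: k1P sM; rewrite !leq_max leqnn !orbT.
    - by apply: k1P tM; rewrite !leq_max leqnn !orbT.
  have := eg2 (x, s, t); rewrite inE => /(_ _)/= <-; last by split.
  have : pn (g2 (x, s, t) - g2 z0) <= p%:R ^- 0.
    apply: PQ => //; split; last first.
      by apply: k4P; apply: le_trans tM _; rewrite pX_le// !leq_max leqnn !orbT.
    apply: P12; split => /=.
      by apply: k2P => l; apply: le_trans (xM l) _; rewrite pX_le// !leq_max leqnn !orbT.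
    by apply: k3P; apply: le_trans sM _; rewrite pX_le// !leq_max leqnn !orbT.
  rewrite expr0 invr1 => H; rewrite -[g2 _](subrK (g2 z0)).
  apply: (@le_trans _ _ n%:R); last by rewrite ler_nat leq_maxl.
  apply: le_trans nP; apply: pnormD_le; last by rewrite le_max lexx orbT.
  by rewrite le_max H.
have /choice[n nP] := second.
(* The successor makes the bound positive, as [taylor_core] requires. *)
pose L := (\max_c n c).+1; exists D, L => x rho xr rho0 rhoL.
apply: (@taylor_core g a D L L%:R) => //.
move=> i j y s t yL sL tL ys yt st.
have nL : (n (i, j) <= L)%N by apply: leqW; exact: leq_bigmax.
have n_le := @pX_le R q _ _ nL.
apply: le_trans (nP (i, j) y s t _ _ _ ys yt st) _ => //=; last by rewrite ler_nat.
- by move=> l; exact: le_trans (yL l) n_le.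
- exact: le_trans sL n_le.
- exact: le_trans tL n_le.
Qed.

(** A single natural number controls the differential, the remainder and the admissible radius, so
    that points can later be sorted into countably many classes. *)
Lemma C2_taylor (m : nat) (U : set 'rV[K]_d) (f : 'rV[K]_d -> 'rV[K]_m) (a : 'rV[K]_d) :
  C2_ultrametric U f -> U a -> exists (D : 'M[K]_(d, m)) (L : nat),
    [/\ forall i j, pn (D i j) <= L%:R &
    forall (x : 'rV[K]_d) (rho : R), (forall i, pn (x 0 i - a 0 i) <= rho) ->
      0 <= rho -> rho <= p%:R ^- L -> forall j,
      pn (f x 0 j - f a 0 j - \sum_i D i j * (x 0 i - a 0 i)) <= L%:R * rho ^+ 2].
Proof.
move=> fC2 Ua; have [X [oX Xa _ C2]] := fC2 a Ua.
have /choice[D /choice[L LP]] := fun k => C2_on_box_taylor oX Xa (C2 k).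
have [n nP] : exists n : nat, forall i j, pn (D j 0 i) <= n%:R.
  have /choice[n nP] := fun c : 'I_d * 'I_m => nat_bound (pn (D c.2 0 c.1)).
  exists (\max_c n c)%N => i j; apply: le_trans (nP (i, j)) _.
  by rewrite ler_nat leq_bigmax.
exists (\matrix_(i, j) D j 0 i), (maxn n (\max_j L j)); split=> [i j|].
  by rewrite mxE; apply: le_trans (nP i j) _; rewrite ler_nat leq_maxl.
move=> x rho xr rho0 rhoL j.
have LjL : (L j <= maxn n (\max_j L j))%N by rewrite leq_max leq_bigmax ?orbT.
rewrite (eq_bigr (fun i => D j 0 i * (x 0 i - a 0 i))) => [|i _]; last by rewrite mxE.
apply: le_trans (LP j x rho xr rho0 _) _.
  by apply: le_trans rhoL _; rewrite pX_le.
by rewrite ler_wpM2r ?exprn_ge0// ler_nat.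
Qed.

End Taylor.

(** * Comparison of real powers *)

Section RealPowers.
Variable R : realType.
Implicit Types (a h A B : R).

Lemma exists_powR_ge a B : 0 < a -> exists H, forall h, H <= h -> B <= h `^ a.
Proof.
move=> a0; exists (Num.max 1 (Num.max 1 B `^ a^-1)) => h.
rewrite ge_max => /andP[h1 hB].
have B1 : 0 <= Num.max 1 B by rewrite le_max ler01.
have : (Num.max 1 B `^ a^-1) `^ a <= h `^ a.
  apply: ge0_ler_powR hB; rewrite ?nnegrE ?powR_ge0//; first exact: ltW.
  by apply: le_trans h1; exact: ler01.
rewrite -powRrM mulVf ?gt_eqF// powRr1//; apply: le_trans.
by rewrite le_max lexx orbT.
Qed.

Lemma powRN_le a h h' : 0 < a -> 0 < h -> h <= h' -> h' `^ (- a) <= h `^ (- a).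
Proof.
move=> a0 h0 hh'; have h'0 : 0 < h' by exact: lt_le_trans hh'.
rewrite !powRN lef_pV2 ?posrE ?powR_gt0//.
by apply: ge0_ler_powR => //; rewrite ?nnegrE ltW.
Qed.

Lemma powRN_dominated A B a b : 0 < A -> 0 < B -> b < a ->
  exists H, forall h, H <= h -> A * h `^ (- a) <= B * h `^ (- b).
Proof.
move=> A0 B0 ba; have ab0 : 0 < a - b by rewrite subr_gt0.
have [H HP] := exists_powR_ge (A / B) ab0.
exists (Num.max 1 H) => h; rewrite ge_max => /andP[h1 Hh].
have h0 : 0 < h by exact: lt_le_trans ltr01 h1.
have := HP h Hh; rewrite ler_pdivrMr// => AB.
have -> : - b = (a - b) + - a by rewrite addrAC subrr add0r.
rewrite powRD; last by rewrite (gt_eqF h0) implybT.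
by rewrite mulrA ler_wpM2r ?powR_ge0// mulrC.
Qed.

Lemma powR_sum (I : Type) (s : seq I) (P : pred I) (F : I -> R) h : 0 < h ->
  h `^ (\sum_(i <- s | P i) F i) = \prod_(i <- s | P i) h `^ F i.
Proof.
move=> h0; apply: (big_morph (fun r => h `^ r)) => [x y|]; last exact: powRr0.
by rewrite powRD// (gt_eqF h0) implybT.
Qed.

Lemma exists_expn_between (p : nat) B : (1 < p)%N -> 1 <= B ->
  exists k : nat, B < p%:R ^+ k <= p%:R * B.
Proof.
move=> p1 B1; have B0 : 0 < B by exact: lt_le_trans ltr01 B1.
have [k0] := exists_invXn_lt p1 (divr_gt0 ltr01 B0).
have p0 : 0 < p%:R :> R by rewrite ltr0n ltnW.
rewrite div1r ltf_pV2 ?posrE ?exprn_gt0// => k0B.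
have ex : exists k, B < p%:R ^+ k by exists k0.
case: (ex_minnP ex) => k kB kmin; exists k; rewrite kB /=.
case: k kB kmin => [|k] kB kmin; first by move: kB; rewrite expr0 ltNge B1.
rewrite exprS; apply: ler_wpM2l; first exact: ltW.
rewrite leNgt; apply/negP => /kmin.
by rewrite ltnn.
Qed.

End RealPowers.

(** * Heights of integer vectors *)

Section Height.
Variables (R : realType) (n : nat).
Implicit Type b : 'rV[int]_n.+1.

Lemma absz_le_height b i : `|b ord0 i|%N%:R <= height R b.
Proof. by rewrite /height ler_nat (leq_bigmax i). Qed.

Lemma height_le b (T : nat) : (forall i, (`|b ord0 i| <= T)%N) -> height R b <= T%:R.
Proof. by move=> bT; rewrite /height ler_nat; apply/bigmax_leqP => i _; exact: bT. Qed.

Lemma height_ge0 b : 0 <= height R b.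
Proof. exact: ler0n. Qed.

Lemma height_ge1 b : b != 0 -> 1 <= height R b.
Proof.
move=> b0; rewrite /height ler1n lt0n; apply: contra b0 => /eqP h0.
apply/eqP/rowP => i; rewrite mxE; apply/eqP; rewrite -absz_eq0 -leqn0; apply: leq_trans (eq_leq h0).
exact: (leq_bigmax i).
Qed.

Lemma heightZ b (t : nat) : height R (t%:Z *: b) = t%:R * height R b.
Proof.
rewrite /height -natrM; congr (_%:R); rewrite big_distrr/=.
by apply: eq_bigr => i _; rewrite mxE abszM.
Qed.

Lemma finite_height_bounded (A : set 'rV[int]_n.+1) : finite_set A ->
  exists M : R, forall b, A b -> height R b <= M.
Proof.
move=> /finite_seqP[s ->]; exists (\sum_(b <- s) height R b) => b /= bs.
by rewrite (big_rem b)//= lerDl; apply: sumr_ge0 => i _; exact: height_ge0.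
Qed.

End Height.

(** Dirichlet's box principle: the values of form [j] fall into [q ^ k] residue classes, so two of
    the [(T + 1) ^ N] vectors with entries in [[0, T]] agree in all classes, and their difference is
    the solution. *)
Lemma pigeonhole_forms (R : realType) (J : finType) (q : J -> primeNat) (k : J -> nat)
    (N T : nat) (l : forall j, 'rV[int]_N -> padic (q j)) :
  (forall j b b', l j (b - b') = l j b - l j b') ->
  (forall j b, pnorm R (l j b) <= 1) ->
  (\prod_j val (q j) ^ k j < T.+1 ^ N)%N ->
  exists b : 'rV[int]_N, [/\ b != 0, forall i, (`|b ord0 i| <= T)%N &
    forall j, pnorm R (l j b) <= (val (q j))%:R ^- k j].
Proof.
move=> lB l1 lt.
have cls j b : exists u : 'I_(val (q j) ^ k j),
    pnorm R (l j b - u%:R) <= (val (q j))%:R ^- k j.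
  have l1' : pnorm R (l j b) <= (val (q j))%:R ^- 0 by rewrite expr0 invr1.
  have [u uk] := pnorm_approx (k j) l1'.
  by rewrite expr0 mulr1 add0n => H; exists (Ordinal uk).
pose v (c : 'rV['I_T.+1]_N) : 'rV[int]_N := map_mx (fun i : 'I_T.+1 => (i : nat)%:Z) c.
pose phi (c : 'rV['I_T.+1]_N) : {dffun forall j, 'I_(val (q j) ^ k j)} :=
  [ffun j => sval (cid (cls j (v c)))].
have /injectivePn[c [c' cc' phicc']] : ~~ injectiveb phi.
  apply/negP => /injectiveP/leq_card.
  rewrite card_dep_ffun card_mx card_ord mul1n leqNgt => /negP; apply.
  rewrite foldrE big_map big_enum/=; under eq_bigr do rewrite card_ord.
  exact: lt.
exists (v c - v c'); split.
- rewrite subr_eq0; apply: contra cc' => /eqP /rowP vv; apply/eqP/rowP => i.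
  by apply/val_inj; have := vv i; rewrite !mxE => -[].
- move=> i; rewrite !mxE; case: (c ord0 i) (c' ord0 i) => [u uT] [u' u'T] /=.
  by lia.
- move=> j; rewrite lB.
  have := svalP (cid (cls j (v c))); have := svalP (cid (cls j (v c'))).
  have := congr1 (fun g : {dffun forall j, 'I_(val (q j) ^ k j)} => g j) phicc'.
  rewrite !ffunE => -> H' H.
  rewrite -(subrKA (sval (cid (cls j (v c'))))%:R); apply: pnormD_le => //.
  by rewrite -pnormN opprB.
Qed.

(** * Dirichlet's theorem for the tangent system *)

Section Dirichlet.
Variables (R : realType) (S : {fset primeNat}) (d m : nat).
Local Notation n := (d + m)%N.
Implicit Types (z : QS S n) (b : 'rV[int]_n.+1).
Implicit Type D : forall nu : S, 'M[padic (val nu)]_(d, m).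

Definition approx_err k (y : QS S k) (b : 'rV[int]_k.+1) (i : 'I_k) (nu : S) :=
  (b 0 ord0)%:~R * y nu 0 i - (b 0 (lift ord0 i))%:~R.

(** When [z] lies on the graph and [D] is the differential there, the last [m] forms measure, up to
    the factor [b_0], how far the rational point [b / b_0] is from the tangent plane at [z]. *)
Definition tangent_form z D b (i : 'I_n) (nu : S) :=
  approx_err z b i nu -
  match fintype.split i with
  | inl _ => 0
  | inr j => \sum_(l < d) D nu l j * approx_err z b (lshift m l) nu
  end.

Definition split_const (C c : R) (i : 'I_n) :=
  match fintype.split i with inl _ => C | inr _ => c end.

Lemma split_lshift (i : 'I_d) : fintype.split (lshift m i) = inl i.
Proof. by rewrite -[lshift m i]/(unsplit (inl i)) unsplitK. Qed.

Lemma split_rshift (j : 'I_m) : fintype.split (rshift d j) = inr j.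
Proof. by rewrite -[rshift d j]/(unsplit (inr j)) unsplitK. Qed.

Lemma approx_errB k (y : QS S k) (b b' : 'rV[int]_k.+1) i nu :
  approx_err y (b - b') i nu = approx_err y b i nu - approx_err y b' i nu.
Proof. by rewrite /approx_err !mxE !rmorphB/=; ring. Qed.

Lemma approx_errZ k (y : QS S k) (b : 'rV[int]_k.+1) (t : int) i nu :
  approx_err y (t *: b) i nu = t%:~R * approx_err y b i nu.
Proof. by rewrite /approx_err !mxE !rmorphM/= mulrBr mulrA. Qed.

Lemma tangent_formB z D b b' i nu :
  tangent_form z D (b - b') i nu = tangent_form z D b i nu - tangent_form z D b' i nu.
Proof.
rewrite /tangent_form approx_errB; case: fintype.split => [_|j]; first by rewrite !subr0.
under eq_bigr do rewrite approx_errB mulrBr.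
by rewrite sumrB; ring.
Qed.

Lemma approx_err_le1 k (y : QS S k) (b : 'rV[int]_k.+1) i nu :
  ZS y -> pnorm R (approx_err y b i nu) <= 1.
Proof.
move=> yZ; apply: pnormB_le; last exact: pnorm_int_le1.
rewrite pnormM mulr_ile1 ?pnorm_ge0 ?pnorm_int_le1//.
by rewrite /pnorm -(rmorph1 (@ratr R)) ler_rat; exact: yZ.
Qed.

Lemma tangent_form_le z D b i nu (L : R) : 1 <= L -> ZS z ->
  (forall l j, pnorm R (D nu l j) <= L) -> pnorm R (tangent_form z D b i nu) <= L.
Proof.
move=> L1 zZ DL; have L0 : 0 <= L by exact: le_trans L1.
apply: pnormB_le; first by apply: le_trans L1; exact: approx_err_le1.
case: fintype.split => [_|j]; first by rewrite pnorm0.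
apply: pnorm_sum_le => // l _; rewrite pnormM -[leRHS]mulr1.
by rewrite ler_pM ?pnorm_ge0 ?approx_err_le1.
Qed.

Variable tau : 'I_n -> S -> R.
Hypothesis tau_gt0 : forall i nu, 0 < tau i nu.
Lemma tangent_form_eq0 z D b :
  (forall i nu, tangent_form z D b i nu = 0) -> forall i nu, approx_err z b i nu = 0.
Proof.
move=> F0; have dir l nu : approx_err z b (lshift m l) nu = 0.
  by have := F0 (lshift m l) nu; rewrite /tangent_form split_lshift subr0.
move=> i nu; have := F0 i nu; rewrite /tangent_form.
case: fintype.split => [_|j]; first by rewrite subr0.
by rewrite big1 ?subr0// => l _; rewrite dir mulr0.
Qed.

(** Unless all its forms vanish, a single [b] solves the system only for bounded [T], and vanishing
    forms mean vanishing errors because the system is triangular. So growing [T] forces growing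
    heights; replacing [T] by the height then only weakens the inequalities. *)
Lemma tangent_dirichlet_unbounded (C c : R) (T0 : nat) z D : 0 < C -> 0 < c ->
  (forall T : nat, (T0 <= T)%N -> exists b,
    [/\ b != 0, height R b <= T%:R & forall i nu,
      pnorm R (tangent_form z D b i nu) < split_const C c i * T%:R `^ (- tau i nu)]) ->
  (exists2 b, b != 0 & forall i nu, approx_err z b i nu = 0) \/
  (forall M : R, exists b, [/\ b != 0, M <= height R b & forall i nu,
    pnorm R (tangent_form z D b i nu) <
      split_const C c i * height R b `^ (- tau i nu)]).
Proof.
move=> C0 c0 HT; case: (pselect (exists2 b, b != 0 & forall i nu, approx_err z b i nu = 0)).
  by left.
move=> nex; right=> M; have [N MN] := nat_bound M.
have k0_gt0 i : 0 < split_const C c i by rewrite /split_const; case: fintype.split.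
have /choice[Tb TbP] : forall b, exists Tb : nat, b != 0 -> exists i nu,
    forall T : nat, (Tb <= T)%N -> split_const C c i * T%:R `^ (- tau i nu) <=
    pnorm R (tangent_form z D b i nu).
  move=> b; have [->|b0] := eqVneq b 0; first by exists 0%N.
  have [i [nu F0]] : exists i nu, tangent_form z D b i nu != 0.
    apply: contrapT => nF; apply: nex; exists b => //; apply: (@tangent_form_eq0 z D) => i nu.
    by apply: contrapT => /eqP F0; apply: nF; exists i, nu.
  have v0 : 0 < pnorm R (tangent_form z D b i nu).
    by rewrite lt_neqAle pnorm_ge0 andbT eq_sym pnorm_eq0.
  have [H HP] := exists_powR_ge
    (split_const C c i / pnorm R (tangent_form z D b i nu)) (tau_gt0 i nu).
  have [K HK] := nat_bound H; exists (K.+1) => _; exists i, nu => T KT.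
  have T_gt0 : 0 < T%:R :> R by rewrite ltr0n; apply: leq_trans KT.
  rewrite powRN ler_pdivrMr ?powR_gt0// mulrC -ler_pdivrMr//; apply: HP.
  by apply: le_trans HK _; rewrite ler_nat ltnW.
(* Enumerates the vectors with entries in [[-N, N]]. Taking [T] beyond the threshold [Tb] of each of
   them excludes every solution of height below [M]. *)
pose dec (u : 'rV['I_(N + N).+1]_n.+1) : 'rV[int]_n.+1 :=
  \row_i ((u 0 i : nat)%:Z - N%:Z).
pose T := maxn T0 (\max_u Tb (dec u)).+1.
have [b [b0 bT bF]] := HT T (leq_maxl _ _).
have T_gt0 : 0 < T%:R :> R by rewrite ltr0n leq_max orbT.
exists b; split=> // [|i nu]; last first.
  apply: lt_le_trans (bF i nu) _; rewrite ler_pM2l//; apply: powRN_le => //.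
  by apply: lt_le_trans (height_ge1 R b0).
rewrite leNgt; apply/negP => bM.
have bE : b = dec (\row_i inord (absz (b 0 i + N%:Z)%R)).
  apply/rowP => i; rewrite !mxE.
  have : `|b ord0 i|%N%:R < N%:R :> R.
    by apply: le_lt_trans (absz_le_height R b i) (lt_le_trans bM MN).
  rewrite ltr_nat -[ord0]/(0 : 'I_1); case: (b 0 i) => u uN.
    by rewrite inordK; lia.
  rewrite inordK; lia.
have [i [nu /(_ T)]] := TbP b b0.
rewrite leNgt bF => /(_ _)/notF; apply.
rewrite leq_max; apply/orP; right; apply: leqW; rewrite bE.
exact: (@leq_bigmax _ (fun u => Tb (dec u))).
Qed.

Hypothesis tau_sum : \sum_(i < n) \sum_(nu : S) tau i nu = n.+1%:R.
Hypotheses (S_neq0 : S != fset0) (d_ge1 : (1 <= d)%N).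

(** As the exponents sum to [n + 1], the pigeonhole count balances up to constants, and a large [C]
    pays for [c] and for all rounding. [C] is fixed before [z] and [D], because it determines the
    shrink factor of the covering argument. *)
Lemma tangent_dirichlet (c : R) (L : nat) : 0 < c <= 1 -> (0 < L)%N ->
  exists C, 1 <= C /\ forall z D, ZS z ->
    (forall nu l j, pnorm R (D nu l j) <= L%:R) ->
    exists T0 : nat, forall T : nat, (T0 <= T)%N -> exists b,
      [/\ b != 0, height R b <= T%:R & forall i nu,
        pnorm R (tangent_form z D b i nu) <
          split_const C c i * T%:R `^ (- tau i nu)].
Proof.
move=> /andP[c0 c1] L0.
have [nu0 nu0S] : exists nu, nu \in S by exact/fset0Pn.
(* A form that carries the constant [C]. *)
pose e0 : 'I_n * S := (lshift m (Ordinal d_ge1), [` nu0S]%fset).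
pose P (e : 'I_n * S) : R := (val (val e.2))%:R.
have P1 e : 1 < P e by rewrite /P ltr1n prime_val_gt1.
have P0 e : 0 < P e by exact: lt_trans ltr01 (P1 e).
(* Losses per form: [p ^ L] for scaling a form bounded by [L] to integral values, and one more [p]
   for rounding up to a power of [p]. *)
pose Q := \prod_(e : 'I_n * S) P e ^+ L.+1.
have Q1 : 1 <= Q.
  apply: (big_ind (fun x => 1 <= x)) => // [x y|e _]; first exact: mulr_ege1.
  by rewrite exprn_ege1// ltW.
pose c' := \prod_(e : 'I_n * S | e != e0) c.
have c'0 : 0 < c' by exact: prodr_gt0.
have c'1 : c' <= 1 by apply: prodr_ile1 => e _; rewrite c1 ltW.
pose C := Q / c'.
have C1 : 1 <= C by rewrite /C ler_pdivlMr// mul1r (le_trans c'1).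
have C0 : 0 < C by exact: lt_le_trans C1.
exists C; split=> // z D zZ DL.
pose k0 i := split_const C c i.
have k0_gt0 i : 0 < k0 i by rewrite /k0 /split_const; case: fintype.split.
have Qk : Q <= \prod_(e : 'I_n * S) k0 e.1.
  rewrite (bigD1 e0)//= /k0 {1}/split_const split_lshift.
  rewrite -ler_pdivrMl//; apply: le_trans (_ : c' <= _); last first.
    apply: ler_prod => e _; rewrite ltW//=.
    rewrite /split_const; case: fintype.split => //= _.
    exact: le_trans c1 C1.
  by rewrite /C invf_div divfK// gt_eqF// (lt_le_trans ltr01).
have /choice[H HP] : forall e : 'I_n * S, exists H : nat,
    forall T : nat, (H <= T)%N -> 1 <= T%:R `^ tau e.1 e.2 / k0 e.1.
  move=> e; have [H HP] := exists_powR_ge (k0 e.1) (tau_gt0 e.1 e.2).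
  have [N HN] := nat_bound H; exists N => T NT.
  rewrite ler_pdivlMr// mul1r; apply: HP; apply: le_trans HN _.
  by rewrite ler_nat.
exists (\max_e H e).+1%N => T TH.
have T0 : 0 < T%:R :> R by rewrite ltr0n; apply: leq_trans TH.
have /choice[k kP] : forall e : 'I_n * S, exists k : nat,
    T%:R `^ tau e.1 e.2 / k0 e.1 < P e ^+ k <= P e * (T%:R `^ tau e.1 e.2 / k0 e.1).
  move=> e; apply: exists_expn_between; first exact: prime_val_gt1.
  by apply: HP; apply: leq_trans (ltnW TH); exact: leq_bigmax.
pose l (e : 'I_n * S) b : padic (val e.2) :=
  (val (val e.2))%:R ^+ L * tangent_form z D b e.1 e.2.
have [|||b [b0 bT bk]] := @pigeonhole_forms R _ (fun e : 'I_n * S => val e.2)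
    (fun e => k e + L)%N n.+1 T l.
- by move=> e b b'; rewrite /l tangent_formB mulrBr.
- move=> e b; rewrite /l pnormM pnorm_primeX mulrC ler_pdivrMr ?exprn_gt0 ?P0// mul1r.
  have := @tangent_form_le z D b e.1 e.2 L%:R.
  rewrite ler1n => /(_ L0 zZ (DL _)) /le_trans; apply.
  by rewrite -natrX ler_nat ltnW// ltn_expl// prime_val_gt1.
- rewrite -(ltr_nat R) natr_prod natrX.
  (* Strictness comes from comparing [T] with [T + 1]; all constants are absorbed in [Q]. *)
  apply: (@le_lt_trans _ _ (T%:R ^+ n.+1)); last first.
    by rewrite ltrXn2r// ?ltr_nat// ltW.
  have -> : T%:R ^+ n.+1 = \prod_(e : 'I_n * S) T%:R `^ tau e.1 e.2 :> R.
    rewrite -powR_sum// -(pair_bigA _ (fun i nu => tau i nu))/= tau_sum.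
    by rewrite powR_mulrn// ltW.
  have -> : \prod_(e : 'I_n * S) T%:R `^ tau e.1 e.2 =
      (\prod_(e : 'I_n * S) k0 e.1) *
      \prod_(e : 'I_n * S) (T%:R `^ tau e.1 e.2 / k0 e.1).
    rewrite -big_split/=; apply: eq_bigr => e _.
    by rewrite mulrC divfK// gt_eqF.
  apply: (@le_trans _ _ (Q * \prod_(e : 'I_n * S) (T%:R `^ tau e.1 e.2 / k0 e.1))).
    rewrite -big_split/=; apply: ler_prod => e _; rewrite ler0n/= natrX exprD mulrC -/(P e).
    have /andP[_ kle] := kP e.
    by rewrite exprSr -mulrA ler_pM2l ?exprn_gt0.
  apply: ler_pM => //; first exact: le_trans Q1.
  by apply: prodr_ge0 => e _; rewrite divr_ge0 ?powR_ge0// ltW.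
exists b; split=> //; first exact: height_le.
move=> i nu; have := bk (i, nu); rewrite /l /= pnormM pnorm_primeX.
have /= /andP[kgt _] := kP (i, nu).
rewrite exprD invfM mulrC ler_pM2r ?invr_gt0 ?exprn_gt0 ?prime_valR_gt0//.
move=> /le_lt_trans; apply; rewrite powRN -[ltRHS]invrK invfM invrK mulrC.
by rewrite ltf_pV2 ?posrE ?exprn_gt0 ?divr_gt0 ?powR_gt0 ?prime_valR_gt0.
Qed.

End Dirichlet.

(** * Lower bound for [|b_0|_nu] from the exponent hypothesis *)

Section OmegaBound.
Variables (R : realType) (S : {fset primeNat}) (n : nat).
Variables (tau : 'I_n -> S -> R) (alpha : R) (nu : S).
Hypotheses (alpha_gt0 : 0 < alpha) (alpha_lt1 : alpha < 1).
Hypothesis alpha_tau : forall i sigma, alpha < tau i sigma.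

Let p := val (val nu).
(** The normalizing factor: the shifted weights are [theta / g], and the critical exponent is
    [g / (1 - alpha)]. *)
Let g : R := (n.+1%:R - n%:R * alpha) / n.+1%:R.
Let theta i sigma : R := if sigma == nu then tau i sigma - alpha else tau i sigma.

Let gnum_gt0 : 0 < n.+1%:R - n%:R * alpha.
Proof.
have : 0 <= n%:R * (1 - alpha) by rewrite mulr_ge0// subr_ge0 ltW.
by rewrite -natr1 mulrBr mulr1; lra.
Qed.

Let g_gt0 : 0 < g. Proof. by rewrite divr_gt0. Qed.

Let theta_gt0 i sigma : 0 < theta i sigma.
Proof.
rewrite /theta; case: ifP => _; first by rewrite subr_gt0.
exact: lt_trans alpha_gt0 (alpha_tau i sigma).
Qed.

Let weightE i sigma : shifted_weight tau nu alpha i sigma = theta i sigma / g.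
Proof. by rewrite /shifted_weight -/(theta i sigma) /g invf_div mulrA. Qed.

Let critE : 1 + alpha / ((1 - alpha) * n.+1%:R) = g / (1 - alpha).
Proof.
rewrite /g -natr1; field.
by rewrite natr1 pnatr_eq0 andbT subr_eq0 gt_eqF.
Qed.

Variables (z : QS S n) (w C : R).
Hypotheses (zZ : ZS z) (C_gt0 : 0 < C).
Hypothesis omega_le : (omega (shifted_weight tau nu alpha) z <= w%:E)%E.
Hypothesis w_lt : w < 1 + alpha / ((1 - alpha) * n.+1%:R).

(** If [|b_0|_nu < h ^ -alpha], then all of [b] is divisible by some [p ^ k] close to [h ^ alpha],
    as [alpha < tau] also makes the errors at [nu] small. The quotient has height about
    [h ^ (1 - alpha)], its errors at [nu] grow by [p ^ k], and those at other places are unchanged.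
    For the weights [theta / g] this gives exponent [g / (1 - alpha)] up to constants, which cannot
    happen for unbounded heights. *)
Lemma omega_pnorm_ge : exists H : R, forall b : 'rV[int]_n.+1, H <= height R b ->
  (forall i sigma,
     pnorm R (approx_err z b i sigma) <= C * height R b `^ (- tau i sigma)) ->
  height R b `^ (- alpha) <= pnorm R ((b 0 ord0)%:~R : padic (val nu)).
Proof.
have p0 : 0 < p%:R :> R by rewrite ltr0n prime_val_gt0.
have p1 : 1 < p%:R :> R by rewrite ltr1n prime_val_gt1.
have a1 : 0 < 1 - alpha by rewrite subr_gt0.
pose crit : R := g / (1 - alpha).
have crit_gt0 : 0 < crit by rewrite divr_gt0.
(* Strictly between [w] and the critical value, leaving room for constants; the maximum with 0 keeps
   [w'] positive, so that [h ^ -w'] decreases in [h]. *)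
pose w' := (Num.max w 0 + crit) / 2.
have max_lt : Num.max w 0 < crit by rewrite gt_max crit_gt0 /crit -critE w_lt.
have ww' : w < w'.
  have : w <= Num.max w 0 by rewrite le_max lexx.
  by rewrite /w'; lra.
have w'0 : 0 < w'.
  have : 0 <= Num.max w 0 by rewrite le_max lexx orbT.
  by rewrite /w'; lra.
have w'g : (1 - alpha) * w' < g.
  by rewrite mulrC -ltr_pdivlMr// -/crit /w'; lra.
apply: contrapT => noH.
suff inf : infinite_set [set b : 'rV[int]_n.+1 |
    \big[Num.max/0]_(i < n) \big[Num.max/0]_(sigma : S)
      pnorm R ((b 0 ord0)%:~R * z sigma 0 i + (b 0 (lift ord0 i))%:~R)
        `^ (shifted_weight tau nu alpha i sigma)^-1
    <= height R b `^ (- w')].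
  have : (w'%:E <= omega (shifted_weight tau nu alpha) z)%E.
    by apply: ereal_sup_ubound; exists w'.
  by move=> /le_trans/(_ omega_le); rewrite lee_fin leNgt ww'.
move=> /(@finite_height_bounded R)[M MP]; apply: noH.
(* Three thresholds: [H1] absorbs [C] and the rounding factor [p], [H2] puts the errors at [nu]
   below [h ^ -alpha], and [H3] pushes the height of the quotient beyond [M]. *)
have /choice[H1 H1P] : forall e : 'I_n * S, exists H, forall h, H <= h ->
    C `^ (theta e.1 e.2 / g)^-1 * h `^ (- g) <=
    p%:R `^ (- w') * h `^ (- ((1 - alpha) * w')).
  by move=> e; apply: powRN_dominated => //; rewrite powR_gt0.
have /choice[H2 H2P] : forall i, exists H, forall h, H <= h ->
    C * h `^ (- tau i nu) <= 1 * h `^ (- alpha).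
  by move=> i; exact: powRN_dominated.
have [H3 H3P] := exists_powR_ge (M + 1) a1.
exists (Num.max (\big[Num.max/1]_e H1 e) (Num.max (\big[Num.max/1]_i H2 i) H3)).
move=> b; rewrite !ge_max => /and3P[hH1 hH2 hH3] errb.
set h := height R b in hH1 hH2 hH3 errb *.
have h1 : 1 <= h by apply: le_trans hH1; exact: bigmax_ge_id.
have h0 : 0 < h by exact: lt_le_trans ltr01 h1.
have {}hH1 e : H1 e <= h by apply: le_trans hH1; exact: le_bigmax.
have {}hH2 i : H2 i <= h by apply: le_trans hH2; exact: le_bigmax.
rewrite leNgt; apply/negP => b0lt.
have ha1 : 1 <= h `^ alpha.
  rewrite -(powRr0 h); apply: ler_powR => //; exact: ltW.
have ha0 : 0 < h `^ alpha by exact: lt_le_trans ltr01 ha1.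
have [k /andP[kgt kle]] := exists_expn_between (prime_val_gt1 (val nu)) ha1.
(* Rounding down: [p ^ k <= h ^ alpha < p ^ k.+1]. *)
case: k kgt kle => [|k] kgt kle; first by move: kgt; rewrite expr0 ltNge ha1.
have {}kle : p%:R ^+ k <= h `^ alpha by move: kle; rewrite exprS ler_pM2l.
have pk0 : 0 < p%:R ^+ k :> R by rewrite exprn_gt0.
have hpk : h `^ (- alpha) <= p%:R ^- k by rewrite powRN lef_pV2.
have bdvd i : (p ^ k %| `|b ord0 i|)%N.
  rewrite -(pnorm_int_le R (val nu)).
  have b0le : pnorm R ((b 0 ord0)%:~R : padic (val nu)) <= p%:R ^- k.
    by apply: le_trans hpk; exact: ltW.
  case: (unliftP ord0 i) => [j ->|->//].
  have -> : (b 0 (lift ord0 j))%:~R =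
      (b 0 ord0)%:~R * z nu 0 j - approx_err z b j nu :> padic (val nu).
    by rewrite /approx_err opprB addrC subrK.
  apply: pnormB_le.
    rewrite pnormM -[leRHS]mulr1 ler_pM ?pnorm_ge0//.
    by rewrite /pnorm -(rmorph1 (@ratr R)) ler_rat; exact: zZ.
  apply: le_trans (errb j nu) _; apply: le_trans (H2P j h (hH2 j)) _.
  by rewrite mul1r.
pose b' : 'rV[int]_n.+1 := \row_i (b ord0 i %/ (p ^ k)%N)%Z.
have bE : b = (p ^ k)%N%:Z *: b'.
  apply/rowP => i; rewrite !mxE mulrC divzK// dvdzE.
  exact: bdvd.
(* [omega] is defined with [b_0 y + b_i] and [approx_err] with [b_0 y - b_i], so the signs of the
   numerators are changed. *)
pose b'' : 'rV[int]_n.+1 := \row_i (if i == ord0 then b' 0 i else - b' 0 i).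
have hb'' : height R b'' = height R b'.
  rewrite /height; congr (_%:R); apply: eq_bigr => i _; rewrite mxE.
  by case: ifP => _; rewrite ?abszN.
have hE : h = p%:R ^+ k * height R b' by rewrite /h bE heightZ natrX.
have h'E : height R b' = h / p%:R ^+ k by rewrite hE mulrC mulKf ?gt_eqF.
have errE i sigma : (b'' 0 ord0)%:~R * z sigma 0 i + (b'' 0 (lift ord0 i))%:~R =
    approx_err z b' i sigma.
  by rewrite /approx_err !mxE /= rmorphN.
have err' i sigma : pnorm R (approx_err z b' i sigma) <= C * h `^ (- theta i sigma).
  have := errb i sigma; rewrite bE approx_errZ pnormM -pmulrn natrX pnormX.
  rewrite /theta; case: eqVneq => [->|sn].
    rewrite pnorm_prime exprVn mulrC ler_pdivrMr// => /le_trans; apply.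
    rewrite opprB addrC powRD; last by rewrite (gt_eqF h0) implybT.
    by rewrite mulrA ler_wpM2l ?mulr_ge0 ?powR_ge0// ltW.
  rewrite pnorm_coprime ?expr1n ?mul1r// prime_coprime ?(valP (val sigma))//.
  by rewrite dvdn_prime2 ?(valP (val sigma)) ?(valP (val nu)).
have h'_ge : h `^ (1 - alpha) <= height R b'.
  rewrite h'E powRB; last by rewrite (gt_eqF h0) implybT.
  by rewrite (powRr1 (ltW h0)) ler_pM2l// lef_pV2 ?posrE.
have h'_le : height R b' <= p%:R * h `^ (1 - alpha).
  rewrite h'E powRB; last by rewrite (gt_eqF h0) implybT.
  rewrite (powRr1 (ltW h0)) mulrCA ler_pM2l// ler_pdivlMr// mulrC ler_pdivrMr//.
  by rewrite -exprS ltW.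
have : height R b'' <= M.
  apply: MP => /=; apply: bigmax_le => [|i _]; first exact: powR_ge0.
  apply: bigmax_le => [|sigma _]; first exact: powR_ge0.
  rewrite errE weightE hb''.
  have th0 := theta_gt0 i sigma; have thg : 0 < theta i sigma / g by rewrite divr_gt0.
  apply: (@le_trans _ _ ((C * h `^ (- theta i sigma)) `^ (theta i sigma / g)^-1)).
    apply: ge0_ler_powR (err' i sigma).
    + by rewrite invr_ge0 ltW.
    + by rewrite nnegrE pnorm_ge0.
    + by rewrite nnegrE mulr_ge0 ?powR_ge0 ?ltW.
  rewrite powRM ?powR_ge0 ?(ltW C_gt0)// -powRrM.
  have -> : - theta i sigma * (theta i sigma / g)^-1 = - g.
    by rewrite invf_div mulNr mulrCA divff ?mulr1// gt_eqF.
  apply: le_trans (H1P (i, sigma) h (hH1 (i, sigma))) _.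
  rewrite -[- ((1 - alpha) * w')]mulrN (powRrM h) -powRM ?powR_ge0 ?(ltW p0)//.
  apply: powRN_le => //; apply: lt_le_trans h'_ge; exact: powR_gt0.
rewrite hb'' leNgt => /negP; apply.
apply: lt_le_trans h'_ge; apply: lt_le_trans (H3P h hH3).
by rewrite ltrDl.
Qed.

End OmegaBound.

(** * Shrinking of the approximation boxes *)

Section DenominatorBounds.
Variables (R : realType) (S : {fset primeNat}) (n : nat).
Variable tau : 'I_n -> S -> R.

(* If b_0 = 0 then a largest entry b_i of b satisfies |b_i|_nu << h^-tau for all
   nu, against the product formula since the exponents sum to more than 1. *)
Lemma denominator_neq0 (z : QS S n) (C : R) : 0 < C ->
  (forall i, 1 < \sum_(nu : S) tau i nu) ->
  exists H : R, forall b : 'rV[int]_n.+1, H <= height R b ->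
    (forall i nu, pnorm R (approx_err z b i nu) <= C * height R b `^ (- tau i nu)) ->
    b 0 ord0 != 0.
Proof.
move=> C0 tau_row; pose Cl := \prod_(nu : S) C.
have Cl0 : 0 < Cl by exact: prodr_gt0.
have /choice[H HP] : forall i, exists H : R, forall h, H <= h ->
    (2 * Cl) * h `^ (- \sum_(nu : S) tau i nu) <= 1 * h `^ (- 1).
  by move=> i; apply: powRN_dominated => //; rewrite mulr_gt0.
exists (\big[Num.max/1]_i H i) => b bH errb; apply/negP => /eqP b00.
have h1 : 1 <= height R b by apply: le_trans bH; exact: bigmax_ge_id.
have h0 : 0 < height R b by exact: lt_le_trans h1.
have [i0 hE] : {i0 | (\max_(i < n.+1) `|b ord0 i|)%N = `|b ord0 i0|%N}.
  by apply: bigop.eq_bigmax; rewrite card_ord.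
have hbE : height R b = `|b ord0 i0|%N%:R by rewrite /height hE.
have bi0 : (0 < `|b ord0 i0|)%N by rewrite -(ltr_nat R) -hbE.
case: (unliftP ord0 i0) => [i i0E|i0E]; last first.
  by move: bi0; rewrite i0E b00.
have Hi : H i <= height R b by apply: le_trans bH; exact: le_bigmax.
have := HP i _ Hi; rewrite mul1r [_ `^ (- 1)]powRN powRr1; last exact: ltW.
have : (height R b)^-1 <= Cl * height R b `^ (- \sum_(nu : S) tau i nu).
  rewrite -sumrN powR_sum// -big_split/=.
  apply: (@le_trans _ _ (\prod_(nu : S) pnorm R ((b 0 i0)%:~R : padic (val nu)))).
    under eq_bigr => nu _ do rewrite pnorm_intE -?absz_gt0//.
    rewrite prodfV lef_pV2 ?posrE//; last first.
      by apply: prodr_gt0 => nu _; rewrite exprn_gt0// prime_valR_gt0.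
    under eq_bigr => nu _ do rewrite -natrX.
    by rewrite -natr_prod hbE ler_nat; exact: prod_logn_le.
  apply: ler_prod => nu _; rewrite pnorm_ge0/=; apply: le_trans (errb i nu).
  by rewrite /approx_err b00 mul0r sub0r pnormN i0E.
have : 0 < Cl * height R b `^ (- \sum_(nu : S) tau i nu).
  by rewrite mulr_gt0 ?powR_gt0.
rewrite -mulrA; lra.
Qed.

Variable alpha : R.
Hypotheses (alpha_gt0 : 0 < alpha) (alpha_lt1 : alpha < 1).
Hypothesis alpha_tau : forall i nu, alpha < tau i nu.
Hypothesis tau_row : forall i, 1 < \sum_(nu : S) tau i nu.

(** The box R_b has radius [C h ^ -tau / |b_0|_nu]. At a place with some exponent at most 1,
    [omega_pnorm_ge] gives [|b_0|_nu >= h ^ -alpha], and [tau > alpha]. At the other places the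
    trivial bound [|b_0|_nu >= 1 / h] is enough, since [tau > 1]. *)
Lemma boxes_shrink (z : QS S n) (C e : R) : 0 < C -> 0 < e -> ZS z ->
  (forall nu, (exists i, tau i nu <= 1) -> exists2 w : R,
     w < 1 + alpha / ((1 - alpha) * n.+1%:R) &
     (omega (shifted_weight tau nu alpha) z <= w%:E)%E) ->
  exists H : R, forall b : 'rV[int]_n.+1, H <= height R b ->
    (forall i nu, pnorm R (approx_err z b i nu) <= C * height R b `^ (- tau i nu)) ->
    b 0 ord0 != 0 /\ forall i nu, C * height R b `^ (- tau i nu) <=
      e * pnorm R ((b 0 ord0)%:~R : padic (val nu)).
Proof.
move=> C0 e0 zZ om; have [H0 H0P] := denominator_neq0 z C0 tau_row.
have /choice[H HP] : forall c : 'I_n * S, exists H : R, forall b : 'rV[int]_n.+1,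
    H <= height R b ->
    (forall i nu, pnorm R (approx_err z b i nu) <= C * height R b `^ (- tau i nu)) ->
    b 0 ord0 != 0 ->
    C * height R b `^ (- tau c.1 c.2) <=
      e * pnorm R ((b 0 ord0)%:~R : padic (val c.2)).
  move=> [i nu] /=; case: (pselect (exists i, tau i nu <= 1)) => [tau1|tau1].
    have [w w1 wom] := om nu tau1.
    have [H1 H1P] := omega_pnorm_ge alpha_gt0 alpha_lt1 alpha_tau zZ C0 wom w1.
    have [H2 H2P] := powRN_dominated C0 e0 (alpha_tau i nu).
    exists (Num.max H1 H2) => b; rewrite ge_max => /andP[bH1 bH2] errb _.
    apply: le_trans (H2P _ bH2) _; rewrite ler_pM2l//; exact: H1P.
  have {}tau1 : 1 < tau i nu.
    by rewrite ltNge; apply/negP => tau1'; apply: tau1; exists i.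
  have [H1 H1P] := powRN_dominated C0 e0 tau1.
  exists (Num.max 1 H1) => b; rewrite ge_max => /andP[bH bH1] _ b00.
  apply: le_trans (H1P _ bH1) _; rewrite ler_pM2l// powRN powRr1; last first.
    exact: le_trans ler01 bH.
  apply: le_trans (pnorm_int_ge R (val nu) b00).
  rewrite lef_pV2 ?posrE ?absz_le_height//.
    exact: lt_le_trans bH.
  by rewrite ltr0n absz_gt0.
exists (Num.max H0 (\big[Num.max/1]_c H c)) => b; rewrite ge_max => /andP[bH0 bH] errb.
have b00 := H0P b bH0 errb; split=> // i nu.
by apply: (HP (i, nu)) => //; apply: le_trans bH; exact: le_bigmax.
Qed.

End DenominatorBounds.

(** * Uniform pieces of the bad set are null *)

Section BadPieces.
Variables (R : realType) (S : {fset primeNat}) (d m : nat).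
Hypotheses (S_neq0 : S != fset0) (d_ge1 : (1 <= d)%N).
Variables (mu : {measure set (QS_borel S d) -> \bar R}) (mu_haar : is_haar mu).
(* [nu] must stay an explicit argument of [U] and [f]. *)
Unset Implicit Arguments.
Variable U : forall nu : S, set 'rV[padic (val nu)]_d.
Variable f : forall nu : S, 'rV[padic (val nu)]_d -> 'rV[padic (val nu)]_m.
Set Implicit Arguments.
Hypothesis U_int : forall nu, U nu `<=` Zp_pow (k := d).
Hypothesis f_int : forall nu, f nu @` U nu `<=` Zp_pow (k := m).
Variable tau : 'I_(d + m) -> S -> R.
Hypothesis tau_gt0 : forall i nu, 0 < tau i nu.
Hypothesis tau_sum : \sum_(i < d + m) \sum_(nu : S) tau i nu = (d + m).+1%:R.
Hypothesis tau_order : forall nu (i : 'I_d) (j : 'I_m),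
  tau (rshift d j) nu <= tau (lshift m i) nu.
Hypothesis tau_row : forall i, 1 < \sum_(nu : S) tau i nu.
Variable alpha : R.
Hypotheses (alpha_gt0 : 0 < alpha) (alpha_lt1 : alpha < 1).
Hypothesis alpha_tau : forall i nu, alpha < tau i nu.
Local Notation pbox := (@pbox R S d).
Local Notation F := (graph_map f).

Definition small_omega (z : QS S (d + m)) := forall nu,
  (exists i, tau i nu <= 1) -> exists2 w : R,
    w < 1 + alpha / ((1 - alpha) * (d + m).+1%:R) &
    (omega (shifted_weight tau nu alpha) z <= w%:E)%E.

Definition taylor_at (L : nat) (D : forall nu : S, 'M[padic (val nu)]_(d, m))
    (x : QS S d) := forall nu,
  (forall i j, pnorm R (D nu i j) <= L%:R) /\
  forall (x' : 'rV[padic (val nu)]_d) (rho : R),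
    (forall i, pnorm R (x' 0 i - x nu 0 i) <= rho) ->
    0 <= rho -> rho <= (val (val nu))%:R ^- L -> forall j,
    pnorm R (f nu x' 0 j - f nu (x nu) 0 j - \sum_i D nu i j * (x' 0 i - x nu 0 i))
      <= L%:R * rho ^+ 2.

(** The constants [c], [N] and [L] are fixed on a piece, so that one shrink factor serves all its
    points. Countably many pieces cover almost all bad points. *)
Definition bad_piece (c : R) (N L : nat) : set (QS S d) :=
  [set x | [/\ prod_set U x, small_omega (F x), exists D, taylor_at L D x &
    forall b : 'rV[int]_(d + m).+1, N%:R <= height R b ->
      ~ forall i nu,
        pnorm R (approx_err (F x) b i nu) < c * height R b `^ (- tau i nu)]].

Lemma graph_map_ZS x : prod_set U x -> ZS (F x).
Proof.
move=> Ux nu i; rewrite /graph_map -[i]splitK /unsplit.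
case: (fintype.split i) => j; first by rewrite row_mxEl; exact: U_int (Ux nu) j.
by rewrite row_mxEr; apply: f_int; exists (x nu) => //; exact: Ux.
Qed.

Lemma approx_err_graphl x b (i : 'I_d) nu :
  approx_err (F x) b (lshift m i) nu =
  (b 0 ord0)%:~R * x nu 0 i - (b 0 (lift ord0 (lshift m i)))%:~R.
Proof. by rewrite /approx_err /graph_map row_mxEl. Qed.

(* The tangent form at x absorbs the first order change of f between x and y. *)
Lemma approx_err_graphr x y D b (j : 'I_m) nu :
  approx_err (F y) b (rshift d j) nu =
  tangent_form (F x) D b (rshift d j) nu +
  \sum_l D nu l j * approx_err (F y) b (lshift m l) nu +
  (b 0 ord0)%:~R * (f nu (y nu) 0 j - f nu (x nu) 0 j -
    \sum_l D nu l j * (y nu 0 l - x nu 0 l)).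
Proof.
rewrite /tangent_form split_rshift.
have -> : \sum_l D nu l j * approx_err (F y) b (lshift m l) nu =
    \sum_l D nu l j * approx_err (F x) b (lshift m l) nu +
    (b 0 ord0)%:~R * \sum_l D nu l j * (y nu 0 l - x nu 0 l).
  rewrite mulr_sumr -big_split/=; apply: eq_bigr => l _.
  by rewrite !approx_err_graphl; ring.
by rewrite /approx_err /graph_map !row_mxEr; ring.
Qed.

(** The alternative of an exact solution [b] is excluded: its multiple by [N.+1] has height at least
    [N] and zero errors, against the definition of the piece. *)
Lemma bad_piece_good_solution (c C : R) (N L T0 : nat) x D : 0 < c -> 0 < C ->
  bad_piece c N L x ->
  (forall T : nat, (T0 <= T)%N -> exists b,
    [/\ b != 0, height R b <= T%:R & forall i nu,
      pnorm R (tangent_form (F x) D b i nu) <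
        split_const C c i * T%:R `^ (- tau i nu)]) ->
  forall M : R, exists b, [/\ b != 0, M <= height R b & forall i nu,
    pnorm R (tangent_form (F x) D b i nu) <
      split_const C c i * height R b `^ (- tau i nu)].
Proof.
move=> c0 C0 [_ _ _ nob] /(tangent_dirichlet_unbounded tau_gt0 C0 c0) [[b b0 berr]|//].
exfalso; apply: (nob (N.+1%:Z *: b)).
  rewrite heightZ; apply: (@le_trans _ _ (N.+1%:R * 1)).
    by rewrite mulr1 ler_nat.
  by rewrite ler_pM2l ?ltr0n// height_ge1.
move=> i nu; rewrite approx_errZ berr mulr0 pnorm0 mulr_gt0// powR_gt0//.
rewrite heightZ mulr_gt0//; exact: lt_le_trans ltr01 (height_ge1 R b0).
Qed.

(** Around each point of the piece there are arbitrarily small boxes R_b. On a sub-box of fixed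
    proportion [b] solves the system with constant [c] and has height at least [N], so the sub-box
    misses the piece and [haar_negligible] applies. *)
Lemma bad_piece_negligible (c : R) (N L : nat) : 0 < c <= 1 -> (0 < L)%N ->
  mu.-negligible (bad_piece c N L : set (QS_borel S d)).
Proof.
move=> c01 L0; have /andP[c0 c1] := c01.
have [C [C1 CP]] := tangent_dirichlet tau_gt0 tau_sum S_neq0 d_ge1 c01 L0.
have C0 : 0 < C by exact: lt_le_trans C1.
have L0' : 0 < L%:R :> R by rewrite ltr0n.
have L1' : 1 <= L%:R :> R by rewrite ler1n.
(* [p ^- K <= 2 ^- K] for every prime, so one [K] serves all places. The extra digit in [K.+1]
   compensates for rounding the radius of the box up to a power of [p]. *)
have [K KP] := exists_invXn_lt (isT : (1 < 2)%N) (divr_gt0 c0 (mulr_gt0 C0 L0')).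
apply: (haar_negligible mu_haar (K := K.+1)) => [x [Ux _ _ _]|].
  by move=> nu; exact: U_int (Ux nu).
move=> x Ex V oV Vx; have [Ux omx [D DP] nob] := Ex.
have zZ := graph_map_ZS Ux.
have DL nu l j : pnorm R (D nu l j) <= L%:R by have [] := DP nu.
have [T0 T0P] := CP (F x) D zZ DL.
have sol := bad_piece_good_solution c0 C0 Ex T0P.
have [kV kVP] : exists k, pbox x (fun _ _ => k) `<=` V.
  by apply/nbhs_QSP; apply: open_nbhs_nbhs; split.
have pc (q : primeNat) : 0 < (val q)%:R ^- (kV + L).+1 :> R.
  by rewrite invr_gt0 exprn_gt0// prime_valR_gt0.
(* The first term keeps the box inside [V] and inside the Taylor radius; the second keeps the
   quadratic remainder below [c h ^ -tau], strictly because of the factor 2. *)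
pose e (nu : S) : R := Num.min ((val (val nu))%:R ^- (kV + L).+1)
  (c / (2 * (L%:R * C * (val (val nu))%:R ^+ 2))).
have e0 (nu : S) : 0 < e nu.
  by rewrite /e lt_min pc/= divr_gt0// !mulr_gt0// ?exprn_gt0// ?prime_valR_gt0.
have e0' : 0 < \big[Num.min/1]_(nu : S) e nu.
  by apply: lt_bigmin => // nu _; exact: e0.
have [H HP] := boxes_shrink alpha_gt0 alpha_lt1 alpha_tau tau_row
  (mulr_gt0 L0' C0) e0' zZ omx.
have [b [b0 bH bF]] := sol (Num.max N%:R H).
move: bH; rewrite ge_max => /andP[bN bH].
have h1 : 1 <= height R b by exact: height_ge1.
have h0 : 0 < height R b by exact: lt_le_trans h1.
set h := height R b in bF bN bH h1 h0.
have bFl l nu : pnorm R (approx_err (F x) b (lshift m l) nu) <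
    C * h `^ (- tau (lshift m l) nu).
  have := bF (lshift m l) nu.
  by rewrite /tangent_form /split_const split_lshift subr0.
have bFr j nu : pnorm R (tangent_form (F x) D b (rshift d j) nu) <
    c * h `^ (- tau (rshift d j) nu).
  by have := bF (rshift d j) nu; rewrite /split_const split_rshift.
have hle l j nu : h `^ (- tau (lshift m l) nu) <= h `^ (- tau (rshift d j) nu).
  by apply: ler_powR => //; rewrite lerN2.
have LC : C <= L%:R * C by rewrite ler_peMl// ltW.
(* Back from tangent forms to errors at [x] itself: the remainder is zero there, and by [tau_order]
   the term with [D] costs only the factor [L]. *)
have errb i nu : pnorm R (approx_err (F x) b i nu) <= L%:R * C * h `^ (- tau i nu).
  rewrite -[i]splitK /unsplit; case: (fintype.split i) => [l|j].
    by apply: le_trans (ltW (bFl l nu)) _; rewrite ler_wpM2r// powR_ge0.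
  rewrite (approx_err_graphr x x D) [X in _ + _ * (_ - X)]big1 => [|l _]; last first.
    by rewrite subrr mulr0.
  rewrite subrr subr0 mulr0 addr0; apply: pnormD_le.
    apply: le_trans (ltW (bFr j nu)) _; rewrite ler_wpM2r ?powR_ge0//.
    by apply: le_trans LC; exact: le_trans c1 C1.
  apply: pnorm_sum_le => [|l _].
    by rewrite !mulr_ge0 ?powR_ge0// ltW.
  rewrite pnormM -mulrA; apply: ler_pM; rewrite ?pnorm_ge0//.
  by apply: le_trans (ltW (bFl l nu)) _; rewrite ler_pM2l.
have [b00 rle] := HP b bH errb.
pose B0 (nu : S) : R := pnorm R ((b 0 ord0)%:~R : padic (val nu)).
have B0_gt0 (nu : S) : 0 < B0 nu.
  rewrite /B0 pnorm_intE// invr_gt0 exprn_gt0//.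
  exact: prime_valR_gt0.
pose r (i : 'I_(d + m)) (nu : S) := C * h `^ (- tau i nu) / B0 nu.
have r0 i nu : 0 < r i nu by rewrite divr_gt0// mulr_gt0// powR_gt0.
have re i nu : r i nu <= e nu.
  rewrite /r ler_pdivrMr//; apply: (@le_trans _ _ (L%:R * C * h `^ (- tau i nu))).
    by rewrite ler_wpM2r// powR_ge0.
  apply: le_trans (rle i nu) _; rewrite ler_wpM2r ?pnorm_ge0//.
  exact: bigmin_le.
have r1 i nu : 1 <= (r i nu)^-1.
  rewrite invf_ge1//; apply: le_trans (re i nu) _.
  apply: (@le_trans _ _ ((val (val nu))%:R ^- (kV + L).+1)).
    by rewrite /e ge_min lexx.
  by rewrite invf_le1 ?exprn_gt0 ?prime_valR_gt0// exprn_ege1// ltW// prime_valR_gt1.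
have /choice[k kP] : forall c : 'I_d * S, exists k : nat,
    r (lshift m c.1) c.2 <= (val (val c.2))%:R ^- k /\
    (val (val c.2))%:R ^- k.+1 < r (lshift m c.1) c.2.
  move=> [i nu] /=; have p0 := prime_valR_gt0 R (val nu).
  have [k] := exists_expn_between (prime_val_gt1 (val nu)) (r1 (lshift m i) nu).
  case: k => [|k] /andP[kgt kle].
    by move: kgt; rewrite expr0 ltNge r1.
  exists k; split; last first.
    by rewrite -[ltRHS]invrK ltf_pV2 ?posrE ?invr_gt0 ?exprn_gt0.
  rewrite -[leLHS]invrK lef_pV2 ?posrE ?invr_gt0 ?exprn_gt0//.
  by move: kle; rewrite exprS ler_pM2l.
(* The centre of the box is the rational point [b / b_0], projected to the first [d] coordinates. *)
pose a : QS S d := fun nu =>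
  \row_i ((b 0 (lift ord0 (lshift m i)))%:~R / (b 0 ord0)%:~R).
have b0nz (nu : S) : (b 0 ord0)%:~R != 0 :> padic (val nu).
  by rewrite -(pnorm_eq0 R) gt_eqF//; exact: B0_gt0.
have errE (y : QS S d) i nu :
    pnorm R (approx_err (F y) b (lshift m i) nu) = B0 nu * pnorm R (y nu 0 i - a nu 0 i).
  by rewrite /B0 -pnormM approx_err_graphl /a mxE mulrBr mulrCA divff ?b0nz// mulr1.
pose Nb (i : 'I_d) (nu : S) := k (i, nu).
have xa : pbox a Nb x.
  move=> i nu; have [/= rk _] := kP (i, nu); apply: le_trans rk.
  by rewrite /r ler_pdivlMr// mulrC -errE ltW.
have pk_lt i nu : (val (val nu))%:R ^- Nb i nu <
    (val (val nu))%:R * r (lshift m i) nu.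
  have [/= _] := kP (i, nu); rewrite exprS invfM mulrC ltr_pdivrMr ?prime_valR_gt0//.
  by rewrite mulrC.
have near_x y i nu : pbox a Nb y ->
    pnorm R (y nu 0 i - x nu 0 i) <= (val (val nu))%:R * r (lshift m i) nu.
  move=> ya; apply: le_trans (ltW (pk_lt i nu)).
  by have := pbox_trans (pbox_sym xa) ya; apply.
have small i nu : (val (val nu))%:R * r i nu <= (val (val nu))%:R ^- (kV + L).
  have p0 := prime_valR_gt0 R (val nu).
  rewrite -ler_pdivlMl//; apply: le_trans (re i nu) _.
  by rewrite /e ge_min exprS invfM lexx.
exists a, Nb; split=> //.
  move=> y ya; apply: kVP => i nu; apply: le_trans (near_x y i nu ya) _.
  by apply: le_trans (small _ _) _; rewrite pX_le// leq_addr.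
apply/seteqP; split=> // y [ya [_ _ _ noby]].
apply: (noby b bN) => i nu.
have p0 := prime_valR_gt0 R (val nu).
(* The division by [L] prepares for the linear term, where these errors are multiplied by entries of
   [D]. *)
have yl l : pnorm R (approx_err (F y) b (lshift m l) nu) <
    c / L%:R * h `^ (- tau (lshift m l) nu).
  rewrite errE mulrC -ltr_pdivlMr//; apply: le_lt_trans (ya l nu) _.
  rewrite addnS -addSn exprD invfM.
  have [/= _ kr] := kP (l, nu).
  apply: (@le_lt_trans _ _ ((val (val nu))%:R ^- (Nb l nu).+1 * (c / (C * L%:R)))).
    rewrite ler_wpM2l ?invr_ge0 ?exprn_ge0//; apply: le_trans (ltW KP).
    rewrite lef_pV2 ?posrE ?exprn_gt0//.
    by apply: lerXn2r; rewrite ?nnegrE// ler_nat prime_val_gt1.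
  apply: (@lt_le_trans _ _ (r (lshift m l) nu * (c / (C * L%:R)))).
    by rewrite ltr_pM2r// divr_gt0// mulr_gt0.
  rewrite le_eqVlt; apply/orP; left; apply/eqP; rewrite /r.
  by field; rewrite (gt_eqF (B0_gt0 nu)) (gt_eqF L0') (gt_eqF C0).
have cL : c / L%:R <= c by rewrite ler_pdivrMr// ler_peMr// ltW.
have yb : pbox a Nb y by apply: pbox_le ya => *; exact: leq_addr.
rewrite -[i]splitK /unsplit; case: (fintype.split i) => [l|j].
  by apply: lt_le_trans (yl l) _; rewrite ler_wpM2r// powR_ge0.
have htau0 : 0 < h `^ (- tau (rshift d j) nu) by rewrite powR_gt0.
(* Three terms: the tangent form, small by the choice of [b]; the linear term, small by [yl] and
   [tau_order]; the Taylor remainder. *)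
rewrite (approx_err_graphr x y D); apply: pnormD_lt; first apply: pnormD_lt => //.
  apply: pnorm_sum_lt => [|l _]; first by rewrite mulr_gt0.
  rewrite pnormM; apply: le_lt_trans (ler_wpM2r (pnorm_ge0 _ _) (DL nu l j)) _.
  rewrite mulrC -ltr_pdivlMr// mulrAC; apply: lt_le_trans (yl l) _.
  by rewrite ler_wpM2l// divr_ge0 ?ltW.
have [_ taylor] := DP nu.
(* By [tau_order] the radius formed with the exponent of coordinate [d + j] dominates those of the
   first [d] coordinates. *)
pose rho := (val (val nu))%:R * r (rshift d j) nu.
have rho0 : 0 <= rho by rewrite mulr_ge0 ?ltW.
have yrho l : pnorm R (y nu 0 l - x nu 0 l) <= rho.
  apply: le_trans (near_x y l nu yb) _; rewrite /rho ler_pM2l// /r.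
  by rewrite ler_pM2r ?invr_gt0// ler_pM2l.
have rhoL : rho <= (val (val nu))%:R ^- L.
  by apply: le_trans (small _ _) _; rewrite pX_le// leq_addl.
rewrite pnormM; apply: le_lt_trans (ler_wpM2l (pnorm_ge0 _ _) (taylor _ _ yrho rho0 rhoL j)) _.
rewrite -/(B0 nu).
have -> : B0 nu * (L%:R * rho ^+ 2) =
    (L%:R * C * (val (val nu))%:R ^+ 2) * r (rshift d j) nu *
    h `^ (- tau (rshift d j) nu).
  by rewrite /rho /r; field; rewrite (gt_eqF (B0_gt0 nu)).
rewrite ltr_pM2r//.
have A0 : 0 < L%:R * C * (val (val nu))%:R ^+ 2 by rewrite !mulr_gt0// ?exprn_gt0.
rewrite mulrC -ltr_pdivlMr//; apply: le_lt_trans (re (rshift d j) nu) _.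
rewrite /e gt_min; apply/orP; right.
rewrite ltr_pM2l// ltf_pV2 ?posrE ?mulr_gt0//.
by rewrite ltr_pMl// ltr1n.
Qed.

End BadPieces.

(** * Covering the bad set by an exceptional null set and countably many pieces *)

Theorem theorem8p13 (R : realType) (S : {fset primeNat}) (d m : nat)
  (S_neq0 : S != fset0) (d_ge1 : (1 <= d)%N) (m_ge1 : (1 <= m)%N)
  (mu : {measure set (QS_borel S d) -> \bar R}) (mu_haar : is_haar mu)
  (U : forall nu : S, set 'rV[padic (val nu)]_d)
  (f : forall nu : S, 'rV[padic (val nu)]_d -> 'rV[padic (val nu)]_m)
  (U_open : forall nu, open (U nu))
  (U_int : forall nu, U nu `<=` Zp_pow (k := d))
  (f_int : forall nu, f nu @` U nu `<=` Zp_pow (k := m))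
  (f_C2 : forall nu, C2_ultrametric (U nu) (f nu))
  (tau : 'I_(d + m) -> S -> R)
  (tau_gt0 : forall i nu, 0 < tau i nu)
  (tau_sum : \sum_(i < d + m) \sum_(nu : S) tau i nu = (d + m).+1%:R)
  (tau_order : forall nu (i : 'I_d) (j : 'I_m),
     tau (rshift d j) nu <= tau (lshift m i) nu)
  (tau_row : forall i, 1 < \sum_(nu : S) tau i nu)
  (exponents : exists alpha : R,
     [/\ 0 < alpha, forall i nu, alpha < tau i nu, alpha < 1 &
         forall nu : S, (exists i, tau i nu <= 1) ->
           (omega_mfd mu (prod_set U) (graph_map f)
              (shifted_weight tau nu alpha)
            < (1 + alpha / ((1 - alpha) * (d + m).+1%:R))%:E)%E]) :
  mu.-negligible (prod_set U `&` graph_map f @^-1` Bad tau).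
Proof.
have [alpha [alpha_gt0 alpha_tau alpha_lt1 om]] := exponents.
have om_ae (nu : S) : {ae mu, forall x, prod_set U x -> (exists i, tau i nu <= 1) ->
    exists2 w : R, w < 1 + alpha / ((1 - alpha) * (d + m).+1%:R) &
      (omega (shifted_weight tau nu alpha) (graph_map f x) <= w%:E)%E}.
  case: (pselect (exists i, tau i nu <= 1)) => [t1|t1]; last exact: aeW.
  (* The infimum lies below the critical value, so some real [w] below it already bounds the
     exponent almost everywhere. *)
  have [_ [w /= wae <-] wlt] := ereal_inf_lt (om nu t1).
  have FF : Filter (almost_everywhere mu) by exact: ae_filter_ringOfSetsType.
  apply: (@filterS _ (almost_everywhere mu) FF _ _ _ wae) => x wx Ux _.
  by exists w; [rewrite -lte_fin|exact: wx].
have small_ae : {ae mu, forall x, forall nu : S, prod_set U x ->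
    (exists i, tau i nu <= 1) ->
    exists2 w : R, w < 1 + alpha / ((1 - alpha) * (d + m).+1%:R) &
      (omega (shifted_weight tau nu alpha) (graph_map f x) <= w%:E)%E}.
  have FF : Filter (almost_everywhere mu) by exact: ae_filter_ringOfSetsType.
  exact: (@filter_forall _ _ _ (almost_everywhere mu) FF om_ae).
(* The successors keep the constants [c] and [L] of the pieces positive. *)
pose P k N L : set (QS_borel S d) := bad_piece U f tau alpha k.+1%:R^-1 N L.+1.
have nP k N L : mu.-negligible (P k N L).
  apply: bad_piece_negligible => //.
  by rewrite invr_gt0 ltr0n invf_le1 ?ltr0n// ler1n.
have nU : mu.-negligible (\bigcup_k \bigcup_N \bigcup_L P k N L).
  by do 3 (apply: negligible_bigcup => ?); exact: nP.
(* A bad point either violates the almost everywhere exponent bound or lies in a piece: outside [W]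
   for [1 / k] it has finitely many solutions, hence a height bound. *)
apply: negligibleS (negligibleU small_ae nU) => x [Ux [_ /existsNP[k /not_implyP[k0 nW]]]].
case: (pselect (small_omega tau alpha (graph_map f x))) => [sx|nsx]; last first.
  by left => sx; apply: nsx => nu; exact: sx.
have zZ := graph_map_ZS U_int f_int Ux.
right; have [k' kE] : exists k', k = k'.+1 by exists k.-1; rewrite prednK.
have /contrapT/(@finite_height_bounded R)[M MP] : ~ infinite_set
    [set b : 'rV[int]_(d + m).+1 | forall i nu,
      pnorm R (approx_err (graph_map f x) b i nu) <
        k%:R^-1 * height R b `^ (- tau i nu)].
  by move=> inf; apply: nW; split.
have [N MN] := nat_bound M.
pose D nu := sval (cid (C2_taylor R (f_C2 nu) (Ux nu))).
have /choice[L DL] := fun nu => svalP (cid (C2_taylor R (f_C2 nu) (Ux nu))).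
(* [N.+1] makes the heights considered in the piece strictly exceed the bound for the solutions. *)
exists k' => //; exists N.+1 => //; exists (\max_nu L nu)%N => //; split=> //.
- exists D => nu; have [DL1 DL2] := DL nu.
  have LM : (L nu <= (\max_nu L nu).+1)%N by apply: leqW; exact: leq_bigmax.
  split=> [i j|x' rho xr rho0 rhoL j].
    by apply: le_trans (DL1 i j) _; rewrite ler_nat.
  apply: le_trans (DL2 x' rho xr rho0 _ j) _.
    by apply: le_trans rhoL _; rewrite pX_le.
  by rewrite ler_wpM2r ?exprn_ge0// ler_nat.
- move=> b bN bF; have := MP b; rewrite /= kE => /(_ bF).
  move=> /le_trans/(_ MN); rewrite leNgt => /negP; apply.
  by apply: lt_le_trans bN; rewrite ltr_nat.
Qed.
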